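(* Let $\Gamma_1, \Gamma_2, \ldots, \Gamma_k$ be $0$- or $1$-dimensional flag simplicial complexes (i.e., triangle-free graphs) such that for each $i$, either $\Gamma_i$ is bipartite or $\Gamma_i - e$ is bipartite for some edge $e$ of $\Gamma_i$. Let $\Gamma = \Gamma_1 * \Gamma_2 * \cdots * \Gamma_k$, where $*$ denotes the simplicial join. Then for every full-dimensional Cohen-Macaulay subcomplex $\Delta$ of $\Gamma$, $f(\Delta)$ is the $f$-vector of some balanced simplicial complex of the same dimension as $\Delta$.
   Context: All simplicial complexes are finite: a simplicial complex $\Delta$ on a finite vertex set $V$ is a set of subsets of $V$ (called faces) closed under inclusion. The dimension of a face $\gamma$ is $|\gamma|-1$, and $\dim(\Delta)$ is the maximum dimension of a face. If $\dim \Delta = d-1$, the $f$-vector is $f(\Delta) = (f_{-1}, f_0, \ldots, f_{d-1})$, where $f_i$ is the number of $i$-dimensional faces; the $h$-vector $(h_0,\ldots,h_d)$ is defined by $\sum_{i=0}^d h_i x^i = \sum_{i=0}^d f_{i-1} x^i (1-x)^{d-i}$. The simplicial join of complexes on disjoint vertex sets is $\Delta_1 * \Delta_2 = \{\tau_1 \cup \tau_2 : \tau_1 \in \Delta_1, \tau_2 \in \Delta_2\}$. A complex is flag if every clique in its $1$-skeleton (viewed as a graph) is a face; a $0$- or $1$-dimensional complex is identified with a graph, and it is flag if and only if this graph has no triangles. $\Gamma_i - e$ denotes the graph obtained by deleting the edge $e$ (keeping its endpoints). A subcomplex $\Delta$ of $\Gamma$ is full-dimensional if $\dim \Delta = \dim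 \Gamma$. A proper $k$-coloring of a complex on $V$ is a map $\kappa: V \to \{1,\dots,k\}$ such that distinct vertices contained in a common face receive different values. A $(d-1)$-dimensional complex is balanced if it has a proper $d$-coloring. Fix a field $\mathbf{k}$ of characteristic zero. For a $(d-1)$-dimensional complex $\Delta$ on $V$, the Stanley-Reisner ring is $\mathbf{k}[\Delta] = \mathbf{k}[x_v : v \in V]/I_\Delta$ (graded by $\deg x_v = 1$), where $I_\Delta$ is generated by the squarefree monomials $x_{v_1}\cdots x_{v_r}$ with $\{v_1,\ldots,v_r\} \notin \Delta$. A linear system of parameters (l.s.o.p.) is a sequence $\theta_1,\ldots,\theta_d$ of elements of $\mathbf{k}[\Delta]_1$ such that $\mathbf{k}[\Delta]/(\theta_1,\ldots,\theta_d)$ is finite-dimensional over $\mathbf{k}$. $\Delta$ is Cohen-Macaulay (over $\mathbf{k}$) if for some (equivalently, every) l.s.o.p. one has $\dim_{\mathbf{k}} (\mathbf{k}[\Delta]/(\theta_1,\ldots,\theta_d))_i = h_i$ for all $0 \le i \le d$. *)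

(* Defs.v *)
From HB Require Import structures.
From mathcomp Require Import all_boot all_order all_algebra.
From mathcomp Require Import mpoly.

Set Implicit Arguments.
Unset Strict Implicit.
Unset Printing Implicit Defensive.

Import Order.TTheory GRing.Theory Num.Theory.

Local Open Scope ring_scope.

(* A complex is given by its set of faces, inside an ambient finite type V.
   Points of V need not be vertices: the vertex set is [vertices D]. *)

Section Complexes.
Variable V : finType.
Implicit Types (D : {set {set V}}) (F G e : {set V}).

Definition simplicial_complex D : Prop :=
  forall F G, F \in D -> G \subset F -> G \in D.

Definition vertices D : {set V} := [set v | [set v] \in D].

(* The number d such that cdim D = d - 1. The complex without any face gets
   d = 0, like {set0}. *)
Definition rk D : nat := \max_(F in D) #|F|.

Definition cdim D : int := (rk D)%:Z - 1.

(* [fnum D i] is f_(i-1), the number of faces with i vertices. *)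
Definition fnum D (i : nat) : nat := #|[set F in D | #|F| == i]|.

Definition fvector D : seq nat := mkseq (fnum D) (rk D).+1.

Definition hpoly D : {poly int} :=
  \sum_(i < (rk D).+1) (fnum D i)%:R *: ('X^i * (1 - 'X) ^+ (rk D - i)).

Definition hnum D (i : nat) : int := (hpoly D)`_i.

(* The case u = v says that the elements of F are vertices of D. *)
Definition skeleton_clique D F : Prop :=
  forall u v, u \in F -> v \in F -> [set u; v] \in D.

Definition flag D : Prop := forall F, skeleton_clique D F -> F \in D.

Definition proper_coloring (k : nat) D (kappa : V -> 'I_k) : Prop :=
  forall F u v, F \in D -> u \in F -> v \in F -> u != v -> kappa u != kappa v.

Definition colorable (k : nat) D : Prop :=
  exists kappa : V -> 'I_k, proper_coloring D kappa.

Definition balanced D : Prop := colorable (rk D) D.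

Definition is_edge D e : Prop := e \in D /\ #|e| = 2.

(* For a complex of dimension at most 1, an edge is a facet, so deleting it
   amounts to removing it from the set of faces: this is [D :\ e]. *)
Definition bipartite D : Prop := colorable 2 D.

Definition sjoin D1 D2 : {set {set V}} := [set F :|: G | F in D1, G in D2].

Definition full_dim_subcomplex D D' : Prop :=
  [/\ simplicial_complex D, D \subset D' & cdim D = cdim D'].

End Complexes.

Section Ideals.
Variable R : comNzRingType.

Definition ideal_gen (S : R -> Prop) (p : R) : Prop :=
  exists s : seq (R * R),
    (forall q, q \in s -> S q.2) /\ p = \sum_(q <- s) q.1 * q.2.

Definition ideal_add (I J : R -> Prop) (p : R) : Prop :=
  exists a b, [/\ I a, J b & p = a + b].

End Ideals.

Section StanleyReisner.
Variables (K : fieldType) (V : finType).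
Implicit Types (D : {set {set V}}).

Local Notation P := {mpoly K[#|V|]}.

Definition xvar (v : V) : P := 'X_(enum_rank v).

Definition sr_ideal D : P -> Prop :=
  ideal_gen (fun g : P => exists2 F : {set V}, F \notin D
                                             & g = \prod_(v in F) xvar v).

(* K[D] is P / sr_ideal D. Elements of K[D]_1 are represented by linear forms
   in P, and K[D] / (theta) is represented as the quotient of P by
   sr_ideal D + (theta). *)
Definition sr_theta_ideal D (d : nat) (theta : 'I_d -> P) : P -> Prop :=
  ideal_add (sr_ideal D) (ideal_gen (fun g : P => exists i, g = theta i)).

(* P / J is finite-dimensional over K. *)
Definition findim_quot (J : P -> Prop) : Prop :=
  exists (m : nat) (b : 'I_m -> P),
    forall p : P, exists c : 'I_m -> K, J (p - \sum_j c j *: b j).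

(* For a homogeneous ideal J, (P / J)_i has dimension m over K: it has a basis
   consisting of the classes of m forms of degree i. *)
Definition quot_dim (J : P -> Prop) (i m : nat) : Prop :=
  exists b : 'I_m -> P,
    [/\ forall j, b j \is i.-homog,
        forall p : P, p \is i.-homog ->
          exists c : 'I_m -> K, J (p - \sum_j c j *: b j)
      & forall c : 'I_m -> K, J (\sum_j c j *: b j) -> forall j, c j = 0].

Definition lsop D (theta : 'I_(rk D) -> P) : Prop :=
  (forall i, theta i \is 1.-homog) /\ findim_quot (sr_theta_ideal D theta).

Definition cohen_macaulay D : Prop :=
  exists theta : 'I_(rk D) -> P,
    lsop theta /\
    forall i, (i <= rk D)%N ->
      exists2 m : nat, quot_dim (sr_theta_ideal D theta) i m
                     & m%:Z = hnum D i.

End StanleyReisner.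

(* Main.v *)
Require Import Defs.
From HB Require Import structures.
From Stdlib Require Import Classical_Prop.
From mathcomp Require Import all_boot all_order all_algebra.
From mathcomp Require Import mpoly zify ring.

Set Implicit Arguments.
Unset Strict Implicit.
Unset Printing Implicit Defensive.

Import Order.TTheory GRing.Theory Num.Theory.

Local Open Scope ring_scope.

(* If the h-vector of Delta is the f-vector of a complex S with a proper d-coloring kappa, then
   the complex of all F u J, with F in S and J a set of colors disjoint from kappa(F), is
   balanced and has h-vector f(S), hence the f-vector of Delta. For S we take the standard
   monomials of K[Delta] modulo a system of d parameters that are sums of vertices. In degree i
   there are h_i of them, because Delta is Cohen-Macaulay and all systems of parameters then
   give the same Hilbert function, and they are closed under divisors.

   If Gamma_i is bipartite with parts A and B, the parameters are the sums over A and over B;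
   then the square of a variable and the product of two variables of the same part vanish. If
   Gamma_i - aa' is bipartite, with a and a' in A, the parameters are the sums over A and over
   B + a', and the variables are ordered so that x_a > x_a' > B > A - {a, a'}. The parameters
   make x_a and x_a' nonstandard. For b in B adjacent to a', x_b^2 = - x_a' x_b, and a is not
   adjacent to b as there is no triangle, so that - x_a' x_b is the sum of the x_v x_b with v
   in A - {a, a'}; hence x_b^2 is not standard either. *)

(** * Exchange of parameters in graded modules *)

(** On generating functions, partial summation is division by 1 - t. This is how a Hilbert function
    changes when a quotient by a nonzerodivisor of degree 1 is undone. *)
Definition psum (f : nat -> int) (i : nat) : int := \sum_(j < i.+1) f j.

Lemma psum0 f : psum f 0 = f 0%N.
Proof. by rewrite /psum big_ord1. Qed.

Lemma psumS f i : psum f i.+1 = psum f i + f i.+1.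
Proof. by rewrite /psum big_ord_recr. Qed.

Lemma psum_inj f g : psum f =1 psum g -> f =1 g.
Proof.
move=> eq_fg [|i]; first by have := eq_fg 0%N; rewrite !psum0.
by apply: (addrI (psum f i)); rewrite -psumS !eq_fg -psumS.
Qed.

Lemma eq_psum f g : f =1 g -> psum f =1 psum g.
Proof. by move=> eq_fg i; apply: eq_bigr. Qed.

Lemma le_psum f g : (forall i, f i <= g i) -> forall i, psum f i <= psum g i.
Proof. by move=> le_fg i; apply: ler_sum. Qed.

Lemma iter_psum_inj n f g : iter n psum f =1 iter n psum g -> f =1 g.
Proof. by elim: n => //= n IHn /psum_inj. Qed.

Lemma eq_iter_psum n f g : f =1 g -> iter n psum f =1 iter n psum g.
Proof. by elim: n => //= n IHn /IHn; apply: eq_psum. Qed.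

Lemma le_iter_psum n f g :
  (forall i, f i <= g i) -> forall i, iter n psum f i <= iter n psum g i.
Proof. by elim: n => //= n IHn /IHn; apply: le_psum. Qed.

Section GradedExchange.
Variables (K : fieldType) (E : nat -> vectType K) (L : eqType).
Variable op : L -> forall i, 'Hom(E i, E i.+1).
Hypothesis opC : forall a b i v, op a i.+1 (op b i v) = op b i.+1 (op a i v).

Implicit Types (U : forall i, {vspace E i}) (a b x y : L) (s t : seq L).

Definition stable U := forall a i, (op a i @: U i <= U i.+1)%VS.

(** The graded submodule U + sE. Degree 0 stands apart because the operators raise degrees by
    one. *)
Definition ext U s i : {vspace E i} :=
  match i with
  | 0 => U 0
  | j.+1 => (U j.+1 + \sum_(a <- s) op a j @: fullv)%VS
  end.

(** The Hilbert function of the quotient E / U, with integer values so that differences can be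
    taken. *)
Definition hilb U i : int := (\dim {:E i})%:Z - (\dim (U i))%:Z.

Definition nonzerodiv U a :=
  forall i v, op a i v \in U i.+1 -> v \in U i.

Lemma ext_cons U a s i : ext U (a :: s) i = ext (ext U s) [:: a] i.
Proof. by case: i => //= i; rewrite big_cons big_seq1 -addvA [(_ + op a i @: _)%VS]addvC. Qed.

Lemma ext_perm U s t : perm_eq s t -> forall i, ext U s i = ext U t i.
Proof. by move=> eq_st [|i] //=; rewrite (perm_big _ eq_st). Qed.

Lemma hilb_ge0 U i : 0 <= hilb U i.
Proof. by rewrite /hilb; have := dimvS (subvf (U i)); lia. Qed.

Lemma eq_hilb U1 U2 : (forall i, U1 i = U2 i) -> hilb U1 =1 hilb U2.
Proof. by move=> eqU i; rewrite /hilb eqU. Qed.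

Lemma sub_ext U s i : (U i <= ext U s i)%VS.
Proof. by case: i => [|i] /=; [apply: subvv | apply: addvSl]. Qed.

Lemma stable_ext U s : stable U -> stable (ext U s).
Proof.
move=> stU b [|i]; first exact: subv_trans (stU b 0%N) (sub_ext U s 1).
rewrite /= limgD; apply: addvS; first exact: stU.
rewrite (big_morph _ (limgD _) (limg0 _)).
elim: s => [|a s IHs]; first by rewrite !big_nil.
rewrite !big_cons; apply: addvS IHs.
apply/subvP=> _ /memv_imgP [_ /memv_imgP [v _ ->] ->].
by rewrite opC memv_img ?memvf.
Qed.

(** Rank-nullity for f restricted to the preimage of A, whose kernel is all of ker f and whose image
    is the intersection of A with im f. *)
Lemma dim_add_limg (aT rT : vectType K) (f : 'Hom(aT, rT)) (A : {vspace rT}) :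
  (\dim (A + limg f) + \dim (f @^-1: A) = \dim A + \dim {:aT})%N.
Proof.
have capE : (f @: (f @^-1: A) = A :&: limg f)%VS.
  apply/vspaceP=> v; rewrite memv_cap.
  apply/memv_imgP/andP => [[u + ->]|[Av /memv_imgP [u _ v_fu]]].
    by rewrite -memv_preim memv_img ?memvf.
  by exists u; rewrite // -memv_preim -v_fu.
have kerE : ((f @^-1: A) :&: lker f = lker f)%VS.
  apply/capv_idPr/subvP=> v; rewrite memv_ker -memv_preim => /eqP ->.
  exact: mem0v.
have := limg_ker_dim f (f @^-1: A); rewrite kerE capE.
have := dimv_sum_cap A (limg f); have := limg_ker_dim f fullv; rewrite capfv.
lia.
Qed.

Lemma hilb_ext1S U a i :
  hilb (ext U [:: a]) i.+1 =
    hilb U i.+1 - ((\dim {:E i})%:Z - (\dim (op a i @^-1: U i.+1))%:Z).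
Proof.
by rewrite /hilb /= big_seq1; have := dim_add_limg (op a i) (U i.+1); lia.
Qed.

Lemma hilb_ext1_0 U a : hilb (ext U [:: a]) 0 = hilb U 0.
Proof. by []. Qed.

Lemma sub_preim U a i : stable U -> (U i <= op a i @^-1: U i.+1)%VS.
Proof.
move=> stU; apply/subvP=> v Uv; rewrite -memv_preim.
exact: (subvP (stU a i)) (memv_img _ Uv).
Qed.

Lemma hilb_ext1_ge U a i : stable U ->
  hilb U i.+1 - hilb U i <= hilb (ext U [:: a]) i.+1.
Proof.
move=> stU; rewrite hilb_ext1S; have := dimvS (sub_preim a i stU).
by rewrite /hilb; lia.
Qed.

Lemma hilb_le_psum1 U a : stable U ->
  forall i, hilb U i <= psum (hilb (ext U [:: a])) i.
Proof.
move=> stU; elim=> [|i IHi]; first by rewrite psum0 hilb_ext1_0.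
by rewrite psumS; have := hilb_ext1_ge a i stU; lia.
Qed.

(** The inequality of [hilb_ext1_ge] is an equality in degree i exactly when the preimage of
    [U i.+1] is [U i], that is, when a acts injectively on the quotient there. *)
Lemma hilb_psum1P U a : stable U ->
  nonzerodiv U a <-> hilb U =1 psum (hilb (ext U [:: a])).
Proof.
move=> stU; split=> [nzU | eqH i v].
  elim=> [|i IHi]; first by rewrite psum0 hilb_ext1_0.
  rewrite psumS -IHi hilb_ext1S.
  have -> : (op a i @^-1: U i.+1)%VS = U i.
    apply/eqP; rewrite eqEsubv sub_preim // andbT; apply/subvP=> v.
    by rewrite -memv_preim; apply: nzU.
  by rewrite /hilb; lia.
have /eqP -> : U i == (op a i @^-1: U i.+1)%VS.
  rewrite eqEdim sub_preim //=.
  by have := eqH i.+1; rewrite psumS -eqH hilb_ext1S /hilb; lia.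
by rewrite -memv_preim.
Qed.

Lemma hilb_le_psum U s : stable U ->
  forall i, hilb U i <= iter (size s) psum (hilb (ext U s)) i.
Proof.
move=> stU; elim: s => [|a s IHs] i.
  by case: i => //= i; rewrite /hilb /= big_nil addv0.
apply: le_trans (IHs i) _; rewrite [size _]/= iterSr.
apply: le_iter_psum => {}i; rewrite (eq_psum (eq_hilb (ext_cons U a s))).
exact/hilb_le_psum1/stable_ext.
Qed.

(* In degrees where [J + (y)] is everything, multiplication by y is onto modulo J; since the
   nonzerodivisor x makes [hilb J] nondecreasing, it is then also injective modulo J. Any
   element killed by y can be pushed into those degrees by powers of x. *)
Lemma nonzerodiv_exchange U x y N : stable U ->
    nonzerodiv U x -> (forall i, (N <= i)%N -> ext U [:: y] i = fullv) ->
  nonzerodiv U y.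
Proof.
move=> stU nzx fully.
have big_deg i v : (N <= i)%N -> op y i v \in U i.+1 -> v \in U i.
  move=> le_Ni yv.
  have /eqP -> : U i == (op y i @^-1: U i.+1)%VS; last by rewrite -memv_preim.
  rewrite eqEdim sub_preim //=.
  have := hilb_ge0 (ext U [:: x]) i.+1.
  have := hilb_ext1S U y i; rewrite /hilb fully ?leqW //.
  have /(hilb_psum1P _ stU) eqx := nzx.
  have := eqx i.+1; rewrite psumS -eqx /hilb; lia.
move=> i; have [k] := ubnP (N - i)%N; elim: k i => // k IHk i lt_k v yv.
have [le_Ni|lt_iN] := leqP N i; first exact: big_deg.
apply: nzx; apply: IHk; first by lia.
by rewrite opC; apply: (subvP (stU x i.+1)) (memv_img _ yv).
Qed.

(** Each parameter costs at most one [psum], so the assumed equality for the whole of [x :: s]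
    forces equality at the stage of x, which is thus a nonzerodivisor modulo s. By
    [nonzerodiv_exchange] so is y, and both Hilbert functions have the same partial sums, namely the
    Hilbert function modulo s. *)
Lemma hilb_exchange U s x y N : stable U ->
    hilb U =1 iter (size s).+1 psum (hilb (ext U (x :: s))) ->
    (forall i, (N <= i)%N -> ext U (y :: s) i = fullv) ->
  hilb (ext U (y :: s)) =1 hilb (ext U (x :: s)).
Proof.
move=> stU eqH fully; have stJ := @stable_ext U s stU.
have nzx : nonzerodiv (ext U s) x.
  apply/hilb_psum1P => //; apply: (@iter_psum_inj (size s)) => i.
  apply/eqP; rewrite eq_le; apply/andP; split.
    exact/le_iter_psum/hilb_le_psum1.
  rewrite -(eq_iter_psum _ (eq_psum (eq_hilb (ext_cons U x s)))).
  by rewrite -iterSr -eqH hilb_le_psum.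
have nzy : nonzerodiv (ext U s) y.
  by apply: nonzerodiv_exchange nzx _ => // i /fully; rewrite ext_cons.
move=> i; rewrite (eq_hilb (ext_cons U y s)) (eq_hilb (ext_cons U x s)); apply: psum_inj i => i.
by rewrite -((hilb_psum1P x stJ).1 nzx) -((hilb_psum1P y stJ).1 nzy).
Qed.

End GradedExchange.

(** * Forms and nonface ideals *)

Section Forms.
Variables (K : fieldType) (n : nat).

Definition monomials d : seq 'X_{1..n} :=
  [seq val m | m <- enum {: 'X_{1..n < d.+1}} & mdeg (val m) == d].

Lemma mem_monomials d m : (m \in monomials d) = (mdeg m == d).
Proof.
apply/mapP/eqP => [[m' + ->]|mdeg_m]; first by rewrite mem_filter => /andP[/eqP].
have lt_m : (mdeg m < d.+1)%N by rewrite mdeg_m.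
by exists (BMultinom lt_m) => //; rewrite mem_filter mem_enum mdeg_m eqxx.
Qed.

Lemma monomials_uniq d : uniq (monomials d).
Proof. by rewrite (map_inj_uniq val_inj) filter_uniq // enum_uniq. Qed.

(* An alias, since the library makes [dhomog] a vector space only in the syntactic form
   [dhomog n.+1 K d]. *)
Definition form d := dhomog n K d.
HB.instance Definition _ d := GRing.Lmodule.on (form d).

(** Meaningful only when m has degree d; otherwise [indhomog] returns a default form. *)
Definition monf d m : form d := indhomog d 'X_[m].

Lemma val_monf d m : mdeg m = d -> val (monf d m) = 'X_[m].
Proof.
move=> deg_m; have hom_m : ('X_[m] : {mpoly K[n]}) \is d.-homog.
  by rewrite dhomogX; apply/eqP.
exact: (insubdK _ hom_m).
Qed.

Lemma form_coeff0 d (p : form d) m : mdeg m != d -> (val p)@_m = 0.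
Proof. exact: dhomog_nemf_coeff (dhomog_is_dhomog p). Qed.

Lemma val_sum_form (I : Type) (r : seq I) (Q : pred I) d (F : I -> form d) :
  val (\sum_(i <- r | Q i) F i) = \sum_(i <- r | Q i) val (F i).
Proof. exact: (raddf_sum (@mpoly_of_dhomog n K d)). Qed.

Lemma coeff_sum_monf d (c : 'X_{1..n} -> K) m : mdeg m = d ->
  (val (\sum_(m' <- monomials d) c m' *: monf d m'))@_m = c m.
Proof.
move=> deg_m; rewrite val_sum_form raddf_sum /=.
rewrite (bigD1_seq m) ?mem_monomials ?deg_m ?monomials_uniq //=.
rewrite mcoeffZ val_monf // mcoeffX eqxx mulr1 big_seq_cond big1 ?addr0 //.
move=> m'; rewrite mem_monomials => /andP[/eqP deg_m' ne_m].
by rewrite mcoeffZ val_monf // mcoeffX (negPf ne_m) mulr0.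
Qed.

Lemma form_sum d (p : form d) :
  p = \sum_(m <- monomials d) (val p)@_m *: monf d m.
Proof.
apply/val_inj/mpolyP => m; have [deg_m|ne_m] := eqVneq (mdeg m) d.
  by rewrite (coeff_sum_monf (fun m => (val p)@_m)).
by rewrite !form_coeff0.
Qed.

Lemma form_vector_axiom d : Vector.axiom (size (monomials d)) (form d).
Proof.
pose mon (i : 'I_(size (monomials d))) : 'X_{1..n} := nth 0%MM (monomials d) i.
have deg_mon i : mdeg (mon i) = d.
  by apply/eqP; rewrite -mem_monomials mem_nth.
have sum_mon (F : 'X_{1..n} -> form d) :
    \sum_(m <- monomials d) F m = \sum_i F (mon i).
  by rewrite (big_nth 0%MM) big_mkord.
pose coefs (p : form d) := \row_i (val p)@_(mon i) : 'rV[K]_(size (monomials d)).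
exists coefs; first by move=> c p q; apply/rowP=> i; rewrite !mxE mcoeffD mcoeffZ.
exists (fun r : 'rV_(size (monomials d)) => \sum_i r 0 i *: monf d (mon i)).
  move=> p; rewrite [RHS]form_sum sum_mon.
  by apply: eq_bigr => i _; rewrite mxE.
move=> r; apply/rowP=> i; rewrite mxE val_sum_form raddf_sum (bigD1 i) //=.
rewrite mcoeffZ val_monf // mcoeffX eqxx mulr1 big1 ?addr0 // => j ne_ji.
rewrite mcoeffZ val_monf // mcoeffX /mon nth_uniq ?monomials_uniq //.
by rewrite (negPf ne_ji : (j == i :> nat) = false) mulr0.
Qed.

HB.instance Definition _ d :=
  Lmodule_hasFinDim.Build K (form d) (form_vector_axiom d).

Lemma span_monf d : <<[seq monf d m | m <- monomials d]>>%VS = fullv.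
Proof.
apply/vspaceP=> p; rewrite memvf [p]form_sum big_seq memv_suml // => m m_in.
by rewrite memvZ // memv_span // map_f.
Qed.

End Forms.

(** * Stanley-Reisner ideals degree by degree *)

Section StanleyReisnerForms.
Variables (K : fieldType) (V : finType).
Local Notation n := #|V|.
Local Notation mon := 'X_{1.. n}.
Implicit Types (m : mon) (D : {set {set V}}) (F G : {set V}) (x : {ffun V -> K}).

Definition mvar (v : V) : mon := U_(enum_rank v)%MM.

Definition msup m : {set V} := [set v | m (enum_rank v) != 0%N].

Lemma mdeg_mvar v : mdeg (mvar v) = 1%N.
Proof. exact: mdeg1. Qed.

Lemma mvarE v w : mvar v (enum_rank w) = (v == w).
Proof. by rewrite mnm1E (inj_eq enum_rank_inj). Qed.

Lemma mdegV m : mdeg m = (\sum_v m (enum_rank v))%N.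
Proof. by rewrite mdegE (reindex enum_rank) //; apply: onW_bij (@enum_rank_bij V). Qed.

Lemma monP m1 m2 : (forall v, m1 (enum_rank v) = m2 (enum_rank v)) -> m1 = m2.
Proof. by move=> eq_m; apply/mnmP => i; rewrite -(enum_valK i). Qed.

Lemma msupD m1 m2 : msup (m1 + m2)%MM = msup m1 :|: msup m2.
Proof. by apply/setP=> v; rewrite !inE mnmDE addn_eq0 negb_and. Qed.

Lemma msup_mvar v : msup (mvar v) = [set v].
Proof. by apply/setP=> w; rewrite !inE mvarE [w == v]eq_sym; case: (v == w). Qed.

Lemma mem_msup_split m v : v \in msup m -> {m' | m = (mvar v + m')%MM}.
Proof.
rewrite inE => m_v; exists (m - mvar v)%MM; apply: monP => w.
by by rewrite mnmDE mnmBE mvarE; case: (v =P w) m_v => [->|_]; lia.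
Qed.

Definition lform x : {mpoly K[n]} := \sum_v x v *: xvar K v.

Lemma lform_homog x : lform x \is 1.-homog.
Proof.
rewrite rpred_sum // => v _; rewrite rpredZ // dhomogX; apply/eqP.
exact: mdeg1.
Qed.

Definition lmul x d (p : form K n d) : form K n d.+1 :=
  DHomog (dhomogM (lform_homog x) (dhomog_is_dhomog p)).

Lemma lmul_linear x d : linear (@lmul x d).
Proof. by move=> c p q; apply: val_inj; rewrite /= mulrDr scalerAr. Qed.

HB.instance Definition _ x d :=
  GRing.isLinear.Build K (form K n d) (form K n d.+1) _ (@lmul x d) (@lmul_linear x d).

Definition lop x d : 'Hom(form K n d, form K n d.+1) := linfun (@lmul x d).

Lemma val_lop x d p : val (lop x d p) = lform x * val p.
Proof. by rewrite lfunE. Qed.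

Lemma lopC x y d p : lop x d.+1 (lop y d p) = lop y d.+1 (lop x d p).
Proof. by apply: val_inj; rewrite !val_lop mulrCA. Qed.

Lemma lop_monf x d m : mdeg m = d ->
  lop x d (monf K d m) = \sum_v x v *: monf K d.+1 (mvar v + m)%MM.
Proof.
move=> deg_m; apply: val_inj; rewrite val_lop val_sum_form val_monf // mulr_suml.
apply: eq_bigr => v _; rewrite /= val_monf; last by rewrite mdegD mdeg_mvar deg_m.
by rewrite mpolyXD scalerAl.
Qed.

(** The degree d part of the Stanley-Reisner ideal: when D is a complex, a monomial lies in that
    ideal exactly when its support is not a face. *)
Definition nonface D d : {vspace form K n d} :=
  <<[seq monf K d m | m <- monomials n d & msup m \notin D]>>%VS.

Lemma monf_nonface D d m : mdeg m = d -> msup m \notin D ->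
  monf K d m \in nonface D d.
Proof.
move=> deg_m mD; rewrite memv_span // map_f // mem_filter mD mem_monomials.
exact/eqP.
Qed.

Lemma mem_nonface D d (p : form K n d) :
  reflect (forall m, msup m \in D -> (val p)@_m = 0) (p \in nonface D d).
Proof.
apply: (iffP idP) => [pD m mD | pD].
  have {}pD : p \in <<in_tuple [seq monf K d m | m <- monomials n d & msup m \notin D]>>%VS.
    by [].
  rewrite (coord_span pD) {pD}.
  rewrite val_sum_form raddf_sum big1 //= => i _; rewrite mcoeffZ.
  have /mapP := mem_nth 0 (ltn_ord i).
  case=> m'; rewrite mem_filter mem_monomials => /andP[m'D /eqP deg_m'] /= ->.
  rewrite val_monf // mcoeffX; case: eqP => [eq_m|_]; last by rewrite mulr0.
  by rewrite eq_m mD in m'D.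
rewrite [p]form_sum big_seq memv_suml // => m; rewrite mem_monomials => /eqP deg_m.
have [mD|mD] := boolP (msup m \in D); first by rewrite pD // scale0r mem0v.
by rewrite memvZ // monf_nonface.
Qed.

Lemma stable_nonface D : simplicial_complex D -> stable lop (nonface D).
Proof.
move=> Dcx x d; rewrite limg_span; apply/span_subvP => _ /mapP[_ /mapP[m m_in ->] ->].
move: m_in; rewrite mem_filter mem_monomials => /andP[mD /eqP deg_m].
rewrite lop_monf // memv_suml // => v _; rewrite memvZ // monf_nonface //.
  by rewrite mdegD mdeg_mvar deg_m.
by apply: contra mD => /Dcx; apply; rewrite msupD subsetUr.
Qed.

(* Equivalently, the restrictions of the forms in s to the vertices of each face span all
   linear forms there, which characterizes linear systems of parameters when s has [rk D]
   elements. *)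
Definition face_spanning D (s : seq {ffun V -> K}) : Prop :=
  forall p : {ffun V -> K}, [set v | p v != 0] \in D ->
    (forall x, x \in s -> \sum_v x v * p v = 0) -> p = 0.

(* If the ideal misses degree d, a linear functional vanishing on it is nonzero at some monomial;
   take one of maximal support F. As d is large, it is [x_v m] with m of support F, and
   [p w := phi (x_w m)] is supported on F and killed by every form of s. *)
Lemma face_spanning_full D s d : simplicial_complex D -> face_spanning D s -> (rk D < d)%N ->
  ext lop (nonface D) s d = fullv.
Proof.
move=> Dcx spanD; case: d => // d lt_d; set U := ext _ _ _ _.
apply/eqP; rewrite eqEsubv subvf /= -span_monf.
(* The projection [phi] has kernel U, so its coefficients play the role of the linear functionals
   vanishing on U. *)
pose phi : 'End(form K n d.+1) := (\1 - projv U)%VF.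
have phiE p : phi p = p - projv U p by rewrite add_lfunE opp_lfunE id_lfunE.
have phi0 p : (p \in U) = (phi p == 0).
  rewrite phiE subr_eq0; apply/idP/eqP => [/projv_id //|->]; exact: memv_proj.
apply/span_subvP => _ /mapP[m + ->]; rewrite mem_monomials.
have [k] := ubnP #|~: msup m|; elim: k m => // k IHk m lt_k deg_m.
have [mD|mD] := boolP (msup m \in D); last first.
  by rewrite (subvP (sub_ext _ _ _ _)) // monf_nonface //; apply/eqP.
have [v m_v] : exists v, (1 < m (enum_rank v))%N.
  apply/existsP; apply: contraLR lt_d; rewrite negb_exists -leqNgt => /forallP le1.
  apply: leq_trans (leq_bigmax_cond (F := fun F : {set V} => #|F|) _ mD).
  rewrite -(eqP deg_m) mdegV -sum1_card [leqRHS]big_mkcond leq_sum // => v _.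
  by have := le1 v; rewrite inE; case: (m _) => [|[]].
have [|m' def_m] := @mem_msup_split m v; first by rewrite inE; case: (m _) m_v.
have deg_m' : mdeg m' = d.
  by move/eqP: deg_m; rewrite def_m mdegD mdeg_mvar add1n => -[].
have sup_m' : msup m' = msup m.
  rewrite def_m msupD msup_mvar; apply/esym/setUidPr; rewrite sub1set inE.
  by move: m_v; rewrite def_m mnmDE mvarE eqxx; case: (m' _).
pose q w := phi (monf K d.+1 (mvar w + m')%MM).
have q0 w : w \notin msup m -> q w = 0.
  move=> mw; apply/eqP; rewrite -phi0; apply: (IHk); last by rewrite mdegD mdeg_mvar deg_m'.
  rewrite ltnS in lt_k; apply: leq_trans lt_k; apply: proper_card; rewrite properEneq.
  rewrite setCS msupD sup_m' subsetUr andbT; apply: contraNneq mw => eqC.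
  have := congr1 (fun F : {set V} => w \in F) eqC.
  by rewrite msup_mvar !in_setC in_setU1 eqxx /= => /esym/negbFE.
rewrite phi0; apply/eqP/val_inj/mpolyP => m0; rewrite mcoeff0.
pose p := [ffun w => (val (q w))@_m0].
have p0 : p = 0.
  apply: spanD => [|x xs].
    apply: (Dcx _ _ mD); apply/subsetP => w; rewrite inE ffunE.
    by apply: contraNT => /q0 ->; rewrite mcoeff0.
  transitivity ((val (phi (lop x d (monf K d m'))))@_m0).
    rewrite lop_monf // linear_sum val_sum_form raddf_sum; apply: eq_bigr => w _.
    by rewrite ffunE linearZ /= mcoeffZ.
  suff /eqP -> : phi (lop x d (monf K d m')) == 0 by rewrite mcoeff0.
  rewrite -phi0 /U /= (subvP (addvSr _ _)) //.
  rewrite (big_rem x) //=; apply: (subvP (addvSl _ _)).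
  by rewrite memv_img ?memvf.
by have := congr1 (fun f : {ffun V -> K} => f v) p0; rewrite !ffunE /q -def_m.
Qed.
End StanleyReisnerForms.

(** * Independence of the system of parameters *)

(** Pigeonhole: each j spoils at most one k, so one of any #|T| + 1 values of k is spoiled by no
    j. *)
Lemma avoid_finite (T : finType) (bad : nat -> T -> Prop) :
    (forall j k k', bad k j -> bad k' j -> k = k') ->
  exists k, forall j, ~ bad k j.
Proof.
move=> bad_inj; apply: NNPP => no_good.
have all_bad (k : 'I_#|T|.+1) : exists j, bad k j.
  by apply: NNPP => no_bad; apply: no_good; exists k => j k_j; apply: no_bad; exists j.
have [f f_bad] := fin_all_exists all_bad.
have /leq_card : injective f.
  move=> i j eq_f; apply: val_inj; apply: (bad_inj (f i)) (f_bad i) _.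
  by rewrite eq_f; apply: f_bad.
by rewrite card_ord ltnn.
Qed.

Section FaceSpanning.
Variables (K : fieldType) (V : finType).
Hypothesis charK : [pchar K] =i pred0.
Implicit Types (D : {set {set V}}) (F G : {set V}) (x a b c p q : {ffun V -> K}).
Implicit Types (s t : seq {ffun V -> K}).

Lemma eq_face_spanning D s t : s =i t -> face_spanning D s -> face_spanning D t.
Proof. by move=> eq_st spanD p pD tp; apply: spanD => // x; rewrite eq_st => /tp. Qed.

Local Definition pair_lf (x p : {ffun V -> K}) : K := \sum_v x v * p v.

Lemma pair_lf_comb x p q (k l : K) :
  pair_lf x [ffun v => k * p v - l * q v] = k * pair_lf x p - l * pair_lf x q.
Proof.
rewrite /pair_lf !mulr_sumr -sumrB; apply: eq_bigr => v _.
by rewrite ffunE; ring.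
Qed.

(* Take c = a + k b: each face excludes at most one value of k on either side. *)
Lemma face_spanning_swap D a b s t : simplicial_complex D ->
    face_spanning D (a :: s) -> face_spanning D (b :: t) ->
  exists c, face_spanning D (c :: s) /\ face_spanning D (c :: t).
Proof.
move=> Dcx spana spanb.
pose c (k : nat) : {ffun V -> K} := [ffun v => a v + k%:R * b v].
have cE k p : pair_lf (c k) p = pair_lf a p + k%:R * pair_lf b p.
  rewrite /pair_lf mulr_sumr -big_split; apply: eq_bigr => v _.
  by rewrite ffunE mulrDl mulrA.
pose side (i : bool) := if i then s else t.
(* A value k is bad at a face and a side if some nonzero p, with support exactly that face, shows
   that [c k] fails to complete that side. *)
pose bad (k : nat) (j : {set V} * bool) :=
  exists p, [/\ j.1 \in D, [set v | p v != 0] = j.1, p <> 0, pair_lf (c k) p = 0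
             & forall x, x \in side j.2 -> pair_lf x p = 0].
have [|k k_good] := @avoid_finite _ bad.
  move=> [F i] k k' [p /= [FD pF p0 cp sp]] [p' [_ /= p'F p'0 cp' sp']].
  apply: contra_not_eq p0 => ne_k.
  pose e := if i then a else b.
  have spane : face_spanning D (e :: side i) by rewrite /e /side; case: (i).
  have qF (u w : K) : [set v | [ffun v => u * p v - w * p' v] v != 0] \in D.
    apply: (Dcx _ _ FD); apply/subsetP => v; apply: contraTT => vF.
    have pv : p v = 0 by apply/eqP; apply: contraNT vF; rewrite -pF inE.
    have p'v : p' v = 0 by apply/eqP; apply: contraNT vF; rewrite -p'F inE.
    by rewrite inE ffunE pv p'v !mulr0 subrr eqxx.
  (* This combination of p and p' is chosen to be killed by e. It is then killed by all of
     [e :: side i] and supported on F, hence zero, so p and p' are proportional in the sense of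
     [pair0]. *)
  have q0 : [ffun v => pair_lf e p' * p v - pair_lf e p * p' v] = 0.
    apply: spane => [|x]; first exact: qF.
    rewrite -/(pair_lf _ _) pair_lf_comb inE => /orP[/eqP -> | x_s]; first by ring.
    by rewrite (sp x) // (sp' x) // !mulr0 subrr.
  have pair0 x : pair_lf e p' * pair_lf x p = pair_lf e p * pair_lf x p'.
    apply/eqP; rewrite -subr_eq0 -pair_lf_comb q0 /pair_lf big1 // => v _.
    by rewrite ffunE mulr0.
  (* Characteristic zero enters here: distinct natural numbers stay distinct in K. *)
  have ke : k%:R - k'%:R != 0 :> K.
    rewrite subr_eq0; apply: contra_neq ne_k => /eqP.
    have wlog_le (m l : nat) : m%:R == l%:R :> K -> (m <= l)%N -> m = l.
      move=> + le_ml; rewrite -(subnK le_ml) natrD -subr_eq0 opprD addrCA subrr addr0.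
      by rewrite oppr_eq0; move/pcharf0P: charK => -> /eqP ->.
    move=> eq_k; have [le_k|/ltnW le_k] := leqP k k'; first exact: wlog_le.
    by apply/esym/wlog_le => //; rewrite eq_sym.
  have [ap ap'] : pair_lf a p = - (k%:R * pair_lf b p) /\
                  pair_lf a p' = - (k'%:R * pair_lf b p').
    by split; apply/eqP; rewrite -addr_eq0 -cE; apply/eqP.
  (* Proportionality gives that k - k' times this product is zero. So b kills p or p', and then a
     kills the same one, against the spanning property of [e :: side i]. *)
  have /eqP : pair_lf b p * pair_lf b p' = 0.
    apply: (mulfI ke); rewrite mulr0; move: (pair0 a) (pair0 b); rewrite /e.
    case: (i) => [_|/esym + _]; rewrite ap ap' => /eqP; rewrite -subr_eq0 => /eqP <-; ring.
  rewrite mulf_eq0 => /orP[] /eqP b0.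
    apply: spane => [|x]; first by rewrite pF.
    rewrite inE => /orP[/eqP ->|/sp //]; rewrite -/(pair_lf _ _) /e.
    by case: (i); rewrite // ap b0 mulr0 oppr0.
  case: p'0; apply: spane => [|x]; first by rewrite p'F.
  rewrite inE => /orP[/eqP ->|/sp' //]; rewrite -/(pair_lf _ _) /e.
  by case: (i); rewrite // ap' b0 mulr0 oppr0.
exists (c k); split=> p pD p_c; apply: NNPP => p0.
  apply: (k_good ([set v | p v != 0], true)); exists p; split=> //.
    by apply: p_c; rewrite mem_head.
  by move=> x x_s; apply: p_c; rewrite inE x_s orbT.
apply: (k_good ([set v | p v != 0], false)); exists p; split=> //.
  by apply: p_c; rewrite mem_head.
by move=> x x_s; apply: p_c; rewrite inE x_s orbT.
Qed.

(** The forms of s are traded for those of t one at a time. Both heads are replaced by a common form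
    w, given by [face_spanning_swap], and w joins the common tail c before the induction hypothesis
    is applied. *)
Lemma hilb_lsop_aux D s t (c : seq {ffun V -> K}) : simplicial_complex D -> size s = size t ->
    face_spanning D (s ++ c) -> face_spanning D (t ++ c) ->
    hilb (nonface K D) =1
      iter (size (s ++ c)) psum (hilb (ext (@lop K V) (nonface K D) (s ++ c))) ->
  hilb (ext (@lop K V) (nonface K D) (t ++ c))
    =1 hilb (ext (@lop K V) (nonface K D) (s ++ c)).
Proof.
move=> Dcx; have stD := stable_nonface (K := K) Dcx; have opC := @lopC K V.
have full r : face_spanning D r -> forall i, (rk D < i)%N -> 
  ext (@lop K V) (nonface K D) r i = fullv.
  by move=> spanD i; apply: face_spanning_full.
elim: s t c => [|a s IHs] [|b t] c //= [eq_sz] spana spanb eqH.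
have [w [spanws spanwt]] := face_spanning_swap Dcx spana spanb.
have perm_w r : perm_eq (r ++ w :: c) (w :: r ++ c).
  by rewrite -cat1s perm_catCA.
have eq_w : hilb (ext (@lop K V) (nonface K D) (w :: s ++ c)) =1 _ :=
  hilb_exchange opC stD eqH (full _ spanws).
have IH : hilb (ext (@lop K V) (nonface K D) (t ++ w :: c))
            =1 hilb (ext (@lop K V) (nonface K D) (s ++ w :: c)).
  apply: IHs => //.
  - by apply: eq_face_spanning spanws => x; rewrite (perm_mem (perm_w s)).
  - by apply: eq_face_spanning spanwt => x; rewrite (perm_mem (perm_w t)).
  move=> i; rewrite (perm_size (perm_w s)) eqH.
  apply: (@eq_iter_psum (size (s ++ c)).+1) => {}i.
  by rewrite (eq_hilb (ext_perm _ _ (perm_w s))) eq_w.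
have eq_t : hilb (ext (@lop K V) (nonface K D) (w :: t ++ c))
              =1 hilb (ext (@lop K V) (nonface K D) (a :: s ++ c)).
  move=> i; rewrite -eq_w -(eq_hilb (ext_perm _ _ (perm_w s))) -IH.
  by rewrite (eq_hilb (ext_perm _ _ (perm_w t))).
move=> i; rewrite -eq_t; apply: (hilb_exchange opC stD _ (full _ spanb)).
move=> j; rewrite eqH !size_cat -eq_sz -size_cat.
apply: (@eq_iter_psum (size (s ++ c)).+1) => {}j.
by rewrite eq_t.
Qed.

Lemma hilb_lsop D s t : simplicial_complex D -> size s = size t ->
    face_spanning D s -> face_spanning D t ->
    hilb (nonface K D) =1 iter (size s) psum (hilb (ext (@lop K V) (nonface K D) s)) ->
  hilb (ext (@lop K V) (nonface K D) t) =1 hilb (ext (@lop K V) (nonface K D) s).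
Proof.
by move=> Dcx eq_sz; have := @hilb_lsop_aux D s t [::] Dcx eq_sz; rewrite !cats0.
Qed.

End FaceSpanning.

(** * From ideals of the polynomial ring to graded subspaces *)

Section Presentation.
Variables (K : fieldType) (V : finType).
Local Notation n := #|V|.
Local Notation P := {mpoly K[n]}.
Implicit Types (D : {set {set V}}) (F G : {set V}).

Definition lcoef (p : P) : {ffun V -> K} := [ffun v => p@_(mvar v)].

Lemma lform_lcoef p : p \is 1.-homog -> lform (lcoef p) = p.
Proof.
move=> hom_p; apply/mpolyP => m; rewrite raddf_sum /=.
under eq_bigr => v _ do rewrite mcoeffZ ffunE mcoeffX.
have [/mdeg1P [i /eqP ->]|m_ne1] := boolP (mdeg m == 1%N).
  rewrite -(enum_valK i) (bigD1 (enum_val i)) //= eqxx mulr1 big1 ?addr0 // => v.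
  by rewrite -(inj_eq enum_rank_inj) eq_mnm1 => /negPf ->; rewrite mulr0.
rewrite (dhomog_nemf_coeff hom_p m_ne1) big1 // => v _.
case: eqP => [eq_m|_]; last by rewrite mulr0.
by case/eqP: m_ne1; rewrite -eq_m mdeg1.
Qed.

Definition theta_coefs d (theta : 'I_d -> P) : seq {ffun V -> K} :=
  [seq lcoef (theta i) | i <- enum 'I_d].

Lemma mem_theta_coefs d (theta : 'I_d -> P) i : lcoef (theta i) \in theta_coefs theta.
Proof. by apply: (map_f (fun i => lcoef (theta i))); rewrite mem_enum. Qed.

Lemma ideal_gen_ind (R : comNzRingType) (S : R -> Prop) (Q : R -> Prop) p :
    Q 0 -> (forall a b, Q a -> Q b -> Q (a + b)) -> (forall a g, S g -> Q (a * g)) ->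
  ideal_gen S p -> Q p.
Proof.
move=> Q0 QD QM [s [sS ->]]; rewrite big_seq.
by elim/big_ind: _ => // q q_s; apply: QM; apply: sS.
Qed.

Lemma prod_xvar F : \prod_(v in F) xvar K v = 'X_[\sum_(v in F) mvar v].
Proof.
by apply/esym; apply: (big_morph (fun m => 'X_[m] : P)) => [m1 m2|]; rewrite ?mpolyXD ?mpolyX0.
Qed.

Lemma msup_sum_mvar F : msup (\sum_(v in F) mvar v)%MM = F.
Proof.
apply/setP=> w; rewrite inE mnm_sumE; have [wF|wF] := boolP (w \in F).
  by rewrite (bigD1 w) //= mvarE eqxx.
rewrite big1 // => v vF; rewrite mvarE; case: eqP => // eq_vw.
by rewrite -eq_vw vF in wF.
Qed.

Lemma sr_ideal_coeff D (a : P) m : simplicial_complex D ->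
  sr_ideal D a -> msup m \in D -> a@_m = 0.
Proof.
move=> Dcx a_sr mD; elim/ideal_gen_ind: a_sr => [|u w u0 w0|u _ [F FD ->]].
- exact: mcoeff0.
- by rewrite mcoeffD u0 w0 addr0.
apply/eqP; apply: contraNT FD; rewrite prod_xvar -mcoeff_msupp (perm_mem (msuppMX _ _)).
case/mapP=> m' _ def_m; apply: Dcx mD _.
by rewrite def_m msupD msup_sum_mvar subsetUl.
Qed.

(** A nonzero p supported on a face and killed by the parameters spans a line in the zero set of the
    ideal. Restriction to that line, sending [xvar v] to p v X, kills the ideal but takes values of
    unbounded degree, which a finite-dimensional quotient forbids. *)
Lemma findim_face_spanning D d (theta : 'I_d -> P) : simplicial_complex D ->
    (forall i, theta i \is 1.-homog) -> findim_quot (sr_theta_ideal D theta) ->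
  face_spanning D (theta_coefs theta).
Proof.
move=> Dcx hom_theta [m [b b_span]] p pD p_theta; apply/ffunP => v0; rewrite ffunE.
apply/eqP; apply: contraT => p_v0.
pose h (i : 'I_n) : {poly K} := p (enum_val i) *: 'X.
pose ev := mmap (@polyC K) h.
have ev_var v : ev (xvar K v) = p v *: 'X.
  by rewrite /ev mmapX mmap1U /h enum_rankK.
have ev_lform x : ev (lform x) = (\sum_v x v * p v) *: 'X.
  rewrite /ev raddf_sum scaler_suml; apply: eq_bigr => v _ /=.
  by rewrite mmapZ [X in _ * X]ev_var mul_polyC scalerA.
have ev_ideal q : sr_theta_ideal D theta q -> ev q = 0.
  case=> a [c [a_sr c_theta ->]]; rewrite /ev rmorphD /=.
  have -> : mmap (@polyC K) h a = 0.
    elim/ideal_gen_ind: a_sr => [|u w u0 w0|u _ [F FD ->]]; first exact: rmorph0.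
      by rewrite rmorphD /= u0 w0 addr0.
    rewrite rmorphM rmorph_prod /=.
    have [v vF pv] : exists2 v, v \in F & p v = 0.
      have /subsetPn[v vF] : ~~ (F \subset [set v | p v != 0]).
        by apply: contra FD; apply: Dcx.
      by rewrite inE negbK => /eqP pv; exists v.
    by rewrite (bigD1 v) //= [mmap _ _ (xvar _ _)]ev_var pv scale0r mul0r mulr0.
  have -> : mmap (@polyC K) h c = 0; last by rewrite addr0.
  elim/ideal_gen_ind: c_theta => [|u w u0 w0|u _ [i ->]]; first exact: rmorph0.
    by rewrite rmorphD /= u0 w0 addr0.
  rewrite rmorphM /= -(lform_lcoef (hom_theta i)) [X in _ * X]ev_lform.
  by rewrite p_theta ?scale0r ?mulr0 // mem_theta_coefs.
(* N bounds the sizes of the images of the spanning family, while the N-th power of p v0 X has size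
   N + 1. *)
pose N := (\max_j size (ev (b j)))%N.
have [c] := b_span (xvar K v0 ^+ N); move/ev_ideal/eqP.
rewrite /ev rmorphB rmorphXn /= [mmap _ _ (xvar _ _)]ev_var subr_eq0 => /eqP ev_N.
have : (size ((p v0 *: 'X) ^+ N : {poly K}) <= N)%N.
  rewrite ev_N raddf_sum; apply: leq_trans (size_sum _ _ _) _.
  apply/bigmax_leqP => j _.
  rewrite /= mmapZ mul_polyC; apply: leq_trans (size_scale_leq _ _) _.
  exact: (leq_bigmax j).
by rewrite exprZn size_scale ?expf_neq0 // size_polyXn ltnn.
Qed.

Definition homcomp d (p : P) : form K n d := DHomog (pihomogP mdeg d p).

Lemma homcomp_linear d : linear (homcomp d).
Proof. by move=> c p q; apply: val_inj; rewrite /= linearP. Qed.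

HB.instance Definition _ d :=
  GRing.isLinear.Build K P (form K n d) _ (homcomp d) (@homcomp_linear d).

Lemma homcomp_val d (p : form K n d) : homcomp d (val p) = p.
Proof. by apply: val_inj; rewrite /= pihomog_dE // dhomog_is_dhomog. Qed.

Lemma homcompM d x p : homcomp d.+1 (p * lform x) = lop x d (homcomp d p).
Proof.
elim/mpolyind: p => [|c m p _ _ IHp]; first by rewrite mul0r !linear0.
rewrite mulrDl -scalerAl !linearP /= IHp; congr (_ *: _ + _); apply: val_inj.
rewrite val_lop /= pihomogX; have hom_m : 'X_[m] * lform x \is (mdeg m).+1.-homog.
  by rewrite mulrC; apply: dhomogM (lform_homog x) _; rewrite dhomogX.
have [deg_m|deg_m] := eqVneq (mdeg m) d.
  by rewrite mulrC pihomog_dE // -deg_m mulrC.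
by rewrite mulr0 (pihomog_ne0 _ hom_m) // eqSS.
Qed.

Lemma homcomp0M x p : homcomp 0 (p * lform x) = 0.
Proof.
elim/mpolyind: p => [|c m p _ _ IHp]; first by rewrite mul0r linear0.
rewrite mulrDl -scalerAl linearP /= IHp addr0; apply: val_inj => /=.
rewrite (@pihomog_ne0 _ _ _ (mdeg m).+1) ?scaler0 //.
by rewrite mulrC; apply: dhomogM (lform_homog x) _; rewrite dhomogX.
Qed.

(** The ideal is homogeneous: components of elements of the Stanley-Reisner ideal have no monomial
    supported on a face, and components of multiples of a parameter are values of [lop]. *)
Lemma homcomp_sr_theta D d (theta : 'I_d -> P) i p : simplicial_complex D ->
    (forall j, theta j \is 1.-homog) -> sr_theta_ideal D theta p ->
  homcomp i p \in ext (@lop K V) (nonface K D) (theta_coefs theta) i.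
Proof.
move=> Dcx hom_theta [a [b [a_sr b_theta ->]]]; rewrite linearD memvD //.
  apply: (subvP (sub_ext _ _ _ _)).
  apply/mem_nonface => m mD; rewrite /= pihomogE raddf_sum big1 //= => m' _.
  rewrite mcoeffZ mcoeffX; case: eqP => [->|_]; last by rewrite mulr0.
  by rewrite (sr_ideal_coeff Dcx a_sr mD) mul0r.
elim/ideal_gen_ind: b_theta => [|u w uD wD|u _ [j ->]].
- by rewrite linear0 mem0v.
- by rewrite linearD memvD.
rewrite -(lform_lcoef (hom_theta j)); case: i => [|i] /=.
  by rewrite (homcomp0M (lcoef (theta j)) u) mem0v.
rewrite (homcompM i (lcoef (theta j)) u) (subvP (addvSr _ _)) //.
rewrite (big_rem (lcoef (theta j))) ?mem_theta_coefs //=.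
by apply: (subvP (addvSl _ _)); rewrite memv_img ?memvf.
Qed.

(** The degree i components of a spanning family still span modulo the graded subspace. Equality is
    recovered later from the opposite bound [hilb_le_psum]. *)
Lemma hilb_quot_dim D d (theta : 'I_d -> P) i m : simplicial_complex D ->
    (forall j, theta j \is 1.-homog) -> quot_dim (sr_theta_ideal D theta) i m ->
  hilb (ext (@lop K V) (nonface K D) (theta_coefs theta)) i <= m%:Z.
Proof.
move=> Dcx hom_theta [b [hom_b span_b _]]; set U := ext _ _ _.
pose B := <<[seq homcomp i (b j) | j <- enum 'I_m]>>%VS.
have full : (fullv <= U i + B)%VS.
  apply/subvP => p _; have [c] := span_b (val p) (dhomog_is_dhomog p).
  move/(homcomp_sr_theta i Dcx hom_theta); rewrite linearB /= homcomp_val -/U => p_U.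
  rewrite -[p](subrK (homcomp i (\sum_j c j *: b j))) memv_add //.
  rewrite linear_sum memv_suml // => j _; rewrite linearZ /= memvZ //.
  by rewrite memv_span //; apply: (map_f (fun j => homcomp i (b j))); rewrite mem_enum.
have := dimvS full; have := dimv_add_leqif (U i) B.
have := dim_span [seq homcomp i (b j) | j <- enum 'I_m].
rewrite size_map size_enum_ord /hilb -/B => ? [? _] ?; lia.
Qed.
End Presentation.

(** * Standard monomials *)

Lemma dim_add_vline (K : fieldType) (vT : vectType K) (W : {vspace vT}) v :
  \dim (W + <[v]>) = (\dim W + (v \notin W))%N.
Proof.
have [vW|vW] := boolP (v \in W).
  by rewrite addn0; move/addv_idPl: (vW : (<[v]> <= W)%VS) => ->.
have := dimv_add_leqif W <[v]>%VS; have := dim_vline v.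
have : (\dim W < \dim (W + <[v]>))%N; last by case: (v != 0) => /=; move=> ? ? [? _]; lia.
rewrite ltnNge; apply: contra vW => le_dim.
have /eqP -> : W == (W + <[v]>)%VS by rewrite eqEdim addvSl.
by apply: (subvP (addvSr _ _)); apply: memv_line.
Qed.

Section StandardMonomials.
Variables (K : fieldType) (V : finType).
Local Notation n := #|V|.
Local Notation mon := 'X_{1.. n}.
Variable wt : V -> nat.
Variable U : forall i, {vspace form K n i}.
Hypothesis stU : stable (@lop K V) U.
Implicit Types (m : mon) (F G : {set V}).

Definition mweight m : nat := (\sum_v m (enum_rank v) * wt v)%N.

(** A monomial order: weights first, ties broken by the order of the library. The weights let each
    factor choose which of its variables are large. *)
Definition mlt m1 m2 : bool :=
  (mweight m1 < mweight m2)%N || (mweight m1 == mweight m2) && (m1 < m2)%O.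

Lemma mweightD m1 m2 : mweight (m1 + m2)%MM = (mweight m1 + mweight m2)%N.
Proof. by rewrite /mweight -big_split; apply: eq_bigr => v _; rewrite mnmDE mulnDl. Qed.

Lemma mweight_mvar v : mweight (mvar v) = wt v.
Proof.
rewrite /mweight (bigD1 v) //= mvarE eqxx mul1n big1 ?addn0 // => w.
by rewrite mvarE eq_sym => /negPf ->.
Qed.

Lemma mlt_irr : irreflexive mlt.
Proof. by move=> m; rewrite /mlt ltnn ltxx andbF. Qed.

Lemma mlt_trans : transitive mlt.
Proof.
move=> m2 m1 m3 /orP[lt12|/andP[/eqP e12 lt12]] /orP[lt23|/andP[/eqP e23 lt23]]; rewrite /mlt.
- by rewrite (ltn_trans lt12).
- by rewrite -e23 lt12.
- by rewrite e12 lt23.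
- by rewrite e12 e23 eqxx (lt_trans lt12 lt23) orbT.
Qed.

Lemma mlt_total m1 m2 : [|| mlt m1 m2, m1 == m2 | mlt m2 m1].
Proof. by rewrite /mlt; case: ltngtP => //= _; case: ltgtP. Qed.

Lemma mlt_add m m1 m2 : mlt m1 m2 -> mlt (m + m1)%MM (m + m2)%MM.
Proof. by rewrite /mlt !mweightD ltn_add2l eqn_add2l ltmc_add2r. Qed.

Lemma monomials_sorted i :
  {s : seq mon | sorted mlt s & perm_eq s (monomials n i)}.
Proof.
pose mle m1 m2 := (m1 == m2) || mlt m1 m2.
have mle_total : total mle.
  move=> m1 m2; rewrite /mle [m2 == _]eq_sym.
  by have /or3P[] := mlt_total m1 m2; move=> ->; rewrite ?orbT.
have mle_trans : transitive mle.
  move=> m2 m1 m3 /orP[/eqP -> //|lt12] /orP[/eqP <-|lt23]; first by rewrite /mle lt12 orbT.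
  by rewrite /mle (mlt_trans lt12 lt23) orbT.
exists (sort mle (monomials n i)); last by rewrite perm_sort.
have uniq_s : uniq (sort mle (monomials n i)) by rewrite sort_uniq monomials_uniq.
have := sort_sorted mle_total (monomials n i); rewrite (sorted_pairwise mle_trans).
rewrite (sorted_pairwise mlt_trans); move: uniq_s; elim: (sort _ _) => //= m s IHs.
case/andP=> m_s /IHs{}IHs /andP[/allP le_m /IHs ->]; rewrite andbT.
apply/allP=> m' m'_s; have := le_m _ m'_s; rewrite /mle.
by case: eqP m'_s m_s => [->|//] ->.
Qed.

Definition smaller i m : {vspace form K n i} :=
  <<[seq monf K i m' | m' <- monomials n i & mlt m' m]>>%VS.

Lemma mem_smaller i m' m : mdeg m' = i -> mlt m' m -> monf K i m' \in smaller i m.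
Proof.
move=> deg_m' lt_m'; rewrite memv_span // map_f // mem_filter lt_m' mem_monomials.
exact/eqP.
Qed.

(** Standard in the sense of Groebner bases: m is not congruent modulo U to a combination of smaller
    monomials of its degree. *)
Definition standard m : bool :=
  monf K (mdeg m) m \notin (U (mdeg m) + smaller (mdeg m) m)%VS.

(** Adjoin the monomials to U in increasing order: the dimension grows by one exactly at the
    standard ones, until the whole space is reached. *)
Lemma hilb_standard i : hilb U i = (count standard (monomials n i))%:Z.
Proof.
have [s sorted_s perm_s] := monomials_sorted i.
have dim_prefix r t : s = r ++ t ->
    \dim (U i + <<[seq monf K i m | m <- r]>>) = (\dim (U i) + count standard r)%N.
  elim/last_ind: r t => [|r m IHr] t def_s; first by rewrite span_nil addv0 addn0.
  rewrite cat_rcons in def_s; have m_s : m \in s.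
    by rewrite def_s mem_cat mem_head orbT.
  have deg_m : mdeg m = i by apply/eqP; rewrite -mem_monomials -(perm_mem perm_s).
  rewrite map_rcons -cats1 span_cat span_seq1 addvA dim_add_vline (IHr _ def_s).
  rewrite -cats1 count_cat /= addn0 -addnA; congr (_ + (_ + _))%N.
  rewrite /standard deg_m /smaller; congr (nat_of_bool (_ \notin _ + _)%VS).
  (* In the sorted list, the monomials before m are exactly those smaller than m. *)
  apply: eq_span => p; apply: eq_mem_map => {}m' //.
  rewrite mem_filter -(perm_mem perm_s) andbC.
  move: sorted_s; rewrite (sorted_pairwise mlt_trans) def_s pairwise_cat mem_cat.
  case/and3P=> /allrelP lt_r _ /= /andP[/allP lt_t _].
  have [m'_r|m'_r] /= := boolP (m' \in r); first by rewrite lt_r ?mem_head.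
  rewrite inE; case: eqP => [->|_] /=; first by rewrite mlt_irr.
  apply/esym/negbTE/negP => /andP[/lt_t lt_mm' lt_m'm].
  by have := mlt_trans lt_mm' lt_m'm; rewrite mlt_irr.
have := dim_prefix s [::]; rewrite cats0 => /(_ erefl).
rewrite (eq_span (Y := [seq monf K i m | m <- monomials n i])); last first.
  by move=> p; apply: eq_mem_map; apply: perm_mem.
rewrite span_monf addvf (permP perm_s) /hilb => ->.
by rewrite PoszD addrAC subrr add0r.
Qed.

(** Contrapositively, multiplying an expression of m through smaller monomials by the variable of v
    gives one for the product, as U is stable and the order is compatible with products. *)
Lemma standard_mvarD v m : standard (mvar v + m)%MM -> standard m.
Proof.
rewrite /standard mdegD mdeg_mvar add1n; set i := mdeg m; apply: contra.
pose x : {ffun V -> K} := [ffun w => (w == v)%:R].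
have lop_x m' : mdeg m' = i -> lop x i (monf K i m') = monf K i.+1 (mvar v + m')%MM.
  move=> deg_m'; rewrite lop_monf // (bigD1 v) //= big1 ?addr0 => [|w ne_w].
    by rewrite ffunE eqxx scale1r.
  by rewrite ffunE (negPf ne_w) scale0r.
rewrite -lop_x // => /(memv_img (lop x i)); apply: subvP.
rewrite limgD; apply: addvS; first exact: stU.
rewrite limg_span; apply/span_subvP => _ /mapP[_ /mapP[m' m'_in ->] ->].
move: m'_in; rewrite mem_filter mem_monomials => /andP[lt_m' /eqP deg_m'].
by rewrite lop_x // mem_smaller ?mlt_add // mdegD mdeg_mvar deg_m'.
Qed.

Lemma standardD m m' : standard (m + m')%MM -> standard m'.
Proof.
have [k] := ubnP (mdeg m); elim: k m => // k IHk m lt_k.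
have [/eqP|m_n0] := eqVneq (mdeg m) 0%N; first by rewrite mdeg_eq0 => /eqP ->; rewrite add0m.
have [v v_m] : exists v, v \in msup m.
  apply/existsP; apply: contraNT m_n0; rewrite negb_exists => /forallP m0.
  by rewrite mdegV big1 // => v _; have := m0 v; rewrite inE negbK => /eqP.
have [m1 def_m] := mem_msup_split v_m; rewrite def_m -addmA => /standard_mvarD.
by apply: IHk; move: lt_k; rewrite def_m mdegD mdeg_mvar; lia.
Qed.

Definition mset F : mon := (\sum_(v in F) mvar v)%MM.

Lemma msetE F v : mset F (enum_rank v) = (v \in F).
Proof.
have := congr1 (fun G : {set V} => v \in G) (msup_sum_mvar F); rewrite inE.
rewrite -/(mset F) mnm_sumE; have [vF|vF] := boolP (v \in F).
  move=> _; rewrite (bigD1 v) //= mvarE eqxx big1 // => w /andP[_ ne_w].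
  by rewrite mvarE (negPf ne_w).
by move/negbFE/eqP.
Qed.

Lemma mdeg_mset F : mdeg (mset F) = #|F|.
Proof. by rewrite mdeg_sum -sum1_card; apply: eq_bigr => v _; rewrite mdeg_mvar. Qed.

Definition standard_faces : {set {set V}} := [set F | standard (mset F)].

Lemma standard_faces_cx : simplicial_complex standard_faces.
Proof.
move=> F G; rewrite !inE => F_std GF; apply: (@standardD (mset (F :\: G))).
rewrite (_ : (_ + _)%MM = mset F) //; apply: monP => v.
rewrite mnmDE !msetE inE; case: (boolP (v \in G)) => [/(subsetP GF) ->|_] //=.
exact: addn0.
Qed.

Section Coloring.
Variables (C : eqType) (kappa : V -> C).
(** The case v = w says that squares of variables are not standard, which makes all standard
    monomials squarefree. *)
Hypothesis kappa_std : forall v w, kappa v = kappa w -> ~~ standard (mvar v + mvar w)%MM.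

Lemma standard_faces_rainbow F v w :
  F \in standard_faces -> v \in F -> w \in F -> v != w -> kappa v != kappa w.
Proof.
rewrite inE => F_std vF wF ne_vw; apply/negP => /eqP /kappa_std /negP; apply.
apply: (@standardD (mset (F :\ v :\ w))).
rewrite (_ : (_ + _)%MM = mset F) //; apply: monP => u.
rewrite !mnmDE !msetE !inE !mvarE ![_ == u]eq_sym.
have [-> | _] := eqVneq u v; first by rewrite vF (negPf ne_vw).
by have [-> | _] := eqVneq u w; rewrite ?wF //= !addn0.
Qed.

Lemma standard_squarefree m : standard m -> m = mset (msup m).
Proof.
move=> m_std; apply: monP => v; rewrite msetE inE.
case def_mv: (m (enum_rank v)) => [|[|k]] //.
have [|m1 def_m] := @mem_msup_split _ m v; first by rewrite inE def_mv.
have [|m2 def_m1] := @mem_msup_split _ m1 v.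
  by rewrite inE; move: def_mv; rewrite def_m mnmDE mvarE eqxx; case: (m1 _).
have /negP[] := kappa_std (erefl (kappa v)); apply: (@standardD m2).
by rewrite addmC -addmA -def_m1 -def_m.
Qed.

Lemma fnum_standard_faces i : (fnum standard_faces i)%:Z = hilb U i.
Proof.
rewrite hilb_standard /fnum -size_filter cardE -(size_map mset); congr (_%:Z).
apply: perm_size; apply: uniq_perm => [||m].
- by rewrite map_inj_uniq ?enum_uniq //; apply: can_inj (@msup_sum_mvar V).
- by rewrite filter_uniq ?monomials_uniq.
rewrite mem_filter mem_monomials; apply/mapP/andP => [[F + ->]|[m_std /eqP deg_m]].
  by rewrite mem_enum !inE mdeg_mset => /andP[].
exists (msup m); last exact: standard_squarefree.
by rewrite mem_enum !inE -mdeg_mset -standard_squarefree // m_std deg_m eqxx.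
Qed.
End Coloring.
End StandardMonomials.

(** * The Hilbert function of a Stanley-Reisner ring *)

Lemma iter_psum_local k f g N : (forall i, (i <= N)%N -> f i = g i) ->
  forall i, (i <= N)%N -> iter k psum f i = iter k psum g i.
Proof.
move=> eq_fg; elim: k => //= k IHk i le_i; apply: eq_bigr => j _.
by apply: IHk; apply: leq_trans le_i; rewrite -ltnS.
Qed.

Lemma psum_coef (B : {poly int}) : psum (fun i => ((1 - 'X) * B)`_i) =1 (fun i => B`_i).
Proof.
have coef_i i : ((1 - 'X) * B)`_i = B`_i - (if i == 0%N then 0 else B`_i.-1).
  by rewrite mulrBl mul1r coefB coefXM.
elim=> [|i IHi]; first by rewrite psum0 coef_i subr0.
by rewrite psumS IHi coef_i addrC subrK.
Qed.

Lemma iter_psum_coef k (B : {poly int}) :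
  iter k psum (fun i => ((1 - 'X) ^+ k * B)`_i) =1 (fun i => B`_i).
Proof.
elim: k => [|k IHk] i /=; first by rewrite expr0 mul1r.
rewrite -iterS iterSr -IHk; apply: eq_iter_psum => {}i.
by rewrite -psum_coef mulrA -exprS.
Qed.

Section HPolynomial.
Variable V : finType.
Implicit Types (D : {set {set V}}) (F : {set V}).

Lemma card_le_rk D F : F \in D -> (#|F| <= rk D)%N.
Proof. exact: (leq_bigmax_cond (F := fun F : {set V} => #|F|)). Qed.

Lemma hpolyE D : hpoly D = \sum_(F in D) 'X^#|F| * (1 - 'X) ^+ (rk D - #|F|).
Proof.
rewrite (partition_big (fun F : {set V} => inord #|F| : 'I_(rk D).+1) xpredT) //=.
apply: eq_bigr => i _.
have eq_i F : F \in D -> (inord #|F| == i :> 'I_(rk D).+1) = (#|F| == i :> nat).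
  by move=> FD; rewrite -val_eqE /= inordK // ltnS card_le_rk.
rewrite (eq_bigr (fun _ => 'X^i * (1 - 'X) ^+ (rk D - i) : {poly int})); last first.
  by move=> F /andP[FD]; rewrite eq_i // => /eqP ->.
rewrite sumr_const scaler_nat; congr (_ *+ _); apply: eq_card => F.
by rewrite !inE; apply: andb_id2l => /eq_i.
Qed.

Lemma size_hpoly D : (size (hpoly D) <= (rk D).+1)%N.
Proof.
apply: leq_trans (size_sum _ _ _) _; apply/bigmax_leqP => i _.
apply: leq_trans (size_scale_leq _ _) _.
apply: leq_trans (size_polyMleq _ _) _; rewrite size_polyXn /=.
have le2 : (size (1 - 'X : {poly int})%R <= 2)%N.
  by rewrite (leq_trans (size_polyD _ _)) // size_polyN size_polyX size_poly1.
have le_exp : (size ((1 - 'X) ^+ (rk D - i) : {poly int})%R <= (rk D - i).+1)%N.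
  rewrite (leq_trans (size_poly_exp_leq _ _)) // ltnS -[leqRHS]mul1n leq_mul2r.
  by apply/orP; right; case: size le2 => [|[|[]]].
rewrite (leq_trans (leq_add (leqnn i) le_exp)) // addnS subnKC //.
by rewrite -ltnS.
Qed.

Lemma hnum_gt D i : (rk D < i)%N -> hnum D i = 0.
Proof. by move=> lt_i; rewrite /hnum nth_default // (leq_trans (size_hpoly D)). Qed.

Lemma fnum_gt D i : (rk D < i)%N -> fnum D i = 0%N.
Proof.
move=> lt_i; apply/eqP; rewrite /fnum cards_eq0; apply/eqP/setP => F; rewrite !inE.
by apply/negP => /andP[/card_le_rk le_F /eqP eq_F]; lia.
Qed.

(** The truncation of X / (1 - X), the generating series of the positive exponents of one
    variable. *)
Definition pos_powers N : {poly int} := \sum_(e < N) 'X^(e.+1).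

(** The monomials with support F have generating series (X / (1 - X))^|F|, and truncating at N does
    not affect degrees up to N. *)
Lemma coef_face_series D N i : (i <= N)%N ->
  (\sum_(F in D) pos_powers N ^+ #|F|)`_i
    = (count (fun m => msup m \in D) (monomials #|V| i))%:Z.
Proof.
move=> le_iN.
pose T := {ffun V -> 'I_N.+1}.
pose sup (f : T) : {set V} := [set v | f v != 0 :> nat].
have faceE F : pos_powers N ^+ #|F|
    = \sum_(f : T | sup f == F) 'X^(\sum_v f v).
  rewrite /pos_powers.
  (* The term is zero unless e is positive exactly for v in F, so the product over all of V expands
     into the exponent vectors with support F. *)
  pose term v (e : 'I_N.+1) : {poly int} := 'X^e *+ ((e != 0 :> nat) == (v \in F)).
  transitivity (\prod_v \sum_e term v e).
    rewrite (bigID (mem F)) /= [X in _ * X]big1 ?mulr1 => [|v vF].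
      rewrite -prodr_const; apply: eq_bigr => v vF.
      rewrite big_ord_recl /term vF /= mulr0n add0r.
      by apply: eq_bigr => e _; rewrite mulr1n.
    rewrite big_ord_recl /term (negPf vF) /= mulr1n big1 ?addr0 //.
  rewrite bigA_distr_bigA /= [RHS]big_mkcond; apply: eq_bigr => f _.
  rewrite /term; case: eqP => [<-|ne_F].
    rewrite -prodrXr; apply: eq_bigr => v _; rewrite inE eqxx mulr1n //.
  have [v ne_v] : exists v, (f v != 0 :> nat) != (v \in F).
    apply/existsP; apply: contra_notT ne_F; rewrite negb_exists => /forallP eq_v.
    by apply/setP => v; rewrite inE; have := eq_v v; rewrite negbK => /eqP.
  by rewrite (bigD1 v) //= (negPf ne_v) mulr0n mul0r.
rewrite (eq_bigr _ (fun F _ => faceE F)).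
have <- : \sum_(f : T | sup f \in D) 'X^(\sum_v f v) =
    \sum_(F in D) \sum_(f : T | sup f == F) 'X^(\sum_v f v) :> {poly int}.
  rewrite (partition_big sup (mem D)) //=; apply: eq_bigr => F FD; apply: eq_bigl => f.
  by rewrite andb_idl // => /eqP ->.
rewrite coef_sum; under eq_bigr => f _ do rewrite coefXn.
rewrite -natr_sum -big_mkcondr /= sum1dep_card natz; congr (_%:Z).
pose mon_of (f : T) : 'X_{1..#|V|} := [multinom (f (enum_val j) : nat) | j < #|V|].
have mon_ofE f v : mon_of f (enum_rank v) = f v by rewrite mnmE enum_rankK.
have sup_mon f : msup (mon_of f) = sup f by apply/setP => v; rewrite !inE mon_ofE.
have deg_mon f : mdeg (mon_of f) = (\sum_v f v)%N.
  by rewrite mdegV; apply: eq_bigr => v _; rewrite mon_ofE.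
rewrite -size_filter cardE -(size_map mon_of).
apply: perm_size; apply: uniq_perm => [||m].
- rewrite map_inj_uniq ?enum_uniq // => f g eq_fg; apply/ffunP => v.
  by apply: val_inj; rewrite /= -!mon_ofE eq_fg.
- by rewrite filter_uniq ?monomials_uniq.
rewrite mem_filter mem_monomials; apply/mapP/andP => [[f + ->]|[mD /eqP deg_m]].
  by rewrite mem_enum inE sup_mon deg_mon eq_sym => /andP[-> ->].
have lt_m v : (m (enum_rank v) < N.+1)%N.
  by rewrite ltnS (leq_trans _ le_iN) // -deg_m mdegV (bigD1 v) //= leq_addr.
pose f : T := [ffun v => Ordinal (lt_m v)].
have def_m : m = mon_of f by apply: monP => v; rewrite mon_ofE ffunE.
exists f => //; rewrite mem_enum inE -sup_mon -def_m mD /= -deg_m def_m deg_mon.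
exact: eqxx.
Qed.

(** Each product of 1 - X with [pos_powers N] is X up to a multiple of X^(N+1), so clearing
    denominators gives the h-polynomial up to such a multiple. *)
Lemma face_series_hpoly D N :
  exists Q : {poly int},
    (1 - 'X) ^+ rk D * (\sum_(F in D) pos_powers N ^+ #|F|) =
      hpoly D + Q * 'X^(N.+1).
Proof.
have powersE : (1 - 'X) * pos_powers N = 'X - 'X^(N.+1).
  rewrite /pos_powers; elim: N => [|N IHN]; first by rewrite big_ord0 mulr0 subrr.
  by rewrite big_ord_recr /= mulrDr IHN mulrBl mul1r -exprS addrA subrK.
(* The cofactor of a - b in a^k - b^k, for a = X - X^(N+1) and b = X. *)
pose R k := \sum_(j < k) ('X - 'X^(N.+1)) ^+ (k.-1 - j) * 'X^j : {poly int}.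
exists (- \sum_(F in D) R #|F| * (1 - 'X) ^+ (rk D - #|F|)).
rewrite hpolyE mulNr mulr_sumr mulr_suml -sumrB; apply: eq_bigr => F FD.
have -> : (1 - 'X) ^+ rk D = (1 - 'X) ^+ #|F| * (1 - 'X) ^+ (rk D - #|F|) :> {poly int}.
  by rewrite -exprD subnKC // card_le_rk.
rewrite mulrAC -exprMn powersE.
have := subrXX ('X - 'X^(N.+1) : {poly int}) 'X #|F|.
have -> : 'X - 'X^(N.+1) - 'X = - 'X^(N.+1) :> {poly int} by rewrite addrAC subrr add0r.
move/eqP; rewrite subr_eq => /eqP ->.
have -> : \sum_(i < #|F|) ('X - 'X^(N.+1)) ^+ (#|F|.-1 - i) * 'X^i = R #|F| by [].
by move: (R _) 'X^(N.+1) 'X^#|F| (_ ^+ (_ - _)) => a b c d; ring.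
Qed.

Variable K : fieldType.

(** A monomial supported on a face is standard because its coefficient functional vanishes on the
    nonface ideal and on all smaller monomials. *)
Lemma hilb_nonface_count D i : hilb (nonface K D) i =
  (count (fun m => msup m \in D) (monomials #|V| i))%:Z.
Proof.
rewrite (hilb_standard (fun _ => 0%N)); congr (_%:Z); apply: eq_count => m.
rewrite /standard; have [mD|mD] := boolP (msup m \in D); last first.
  by apply/negbF/(subvP (addvSl _ _))/monf_nonface.
pose ev (p : form K #|V| (mdeg m)) : K^o := (val p)@_m.
have ev_lin : linear ev by move=> c p q; rewrite /ev mcoeffD mcoeffZ.
pose evL : {linear form K #|V| (mdeg m) -> K^o} :=
  HB.pack ev (GRing.isLinear.Build _ _ _ _ ev ev_lin).
have ker_ev p : (p \in lker (linfun evL)) = ((val p)@_m == 0).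
  by rewrite memv_ker lfunE.
have sub_ker : (nonface K D (mdeg m) + smaller K (fun _ => 0%N) (mdeg m) m
                 <= lker (linfun evL))%VS.
  rewrite subv_add; apply/andP; split.
    by apply/subvP => p /mem_nonface /(_ m mD) p_m; rewrite ker_ev p_m.
  apply/span_subvP => _ /mapP[m' m'_in ->]; rewrite ker_ev.
  move: m'_in; rewrite mem_filter mem_monomials => /andP[lt_m' /eqP deg_m'].
  rewrite val_monf // mcoeffX; case: (m' =P m) lt_m' => [->|_ _]; last exact: eqxx.
  by rewrite mlt_irr.
apply/negP => /(subvP sub_ker); rewrite ker_ev val_monf // mcoeffX eqxx.
by rewrite oner_eq0.
Qed.

(** The Hilbert series of the Stanley-Reisner ring is the h-polynomial over (1 - X)^d, with d the
    rank of D. Truncating the series at i leaves the degrees up to i intact. *)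
Lemma hilb_nonface D : hilb (nonface K D) =1 iter (rk D) psum (hnum D).
Proof.
move=> i; rewrite hilb_nonface_count -(@coef_face_series D i) //.
have [Q eqQ] := face_series_hpoly D i.
rewrite -(iter_psum_coef (rk D)) eqQ; apply: iter_psum_local (leqnn i) => j le_j.
by rewrite coefD coefMXn ltnS le_j addr0.
Qed.

(** For the given parameters theta the h-numbers are an upper bound by hypothesis. With
    [hilb_le_psum] and [hilb_nonface] this forces equality after summation, and [hilb_lsop] carries
    the Hilbert function over to s. *)
Lemma cohen_macaulay_hilb D s : [pchar K] =i pred0 -> simplicial_complex D ->
    cohen_macaulay K D -> size s = rk D -> face_spanning D s ->
  hilb (ext (@lop K V) (nonface K D) s) =1 hnum D.
Proof.
move=> charK Dcx [theta [[hom_theta fin_theta] dims]] sz_s span_s.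
set s0 := theta_coefs theta; have stD := stable_nonface (K := K) Dcx.
have span_s0 : face_spanning D s0 by apply: findim_face_spanning.
have sz_s0 : size s0 = rk D by rewrite size_map size_enum_ord.
have le_h i : hilb (ext (@lop K V) (nonface K D) s0) i <= hnum D i.
  have [le_i|lt_i] := leqP i (rk D).
    by have [m /(hilb_quot_dim Dcx hom_theta) + <-] := dims i le_i.
  by rewrite hnum_gt // /hilb face_spanning_full // subrr.
have eq_psum_h : hilb (nonface K D) =1
    iter (size s0) psum (hilb (ext (@lop K V) (nonface K D) s0)).
  move=> i; apply: le_anti; rewrite hilb_le_psum //= => [|x y d p]; last exact: lopC.
  by rewrite hilb_nonface -sz_s0 le_iter_psum.
move=> i; rewrite (hilb_lsop charK Dcx _ span_s0) ?sz_s0 //.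
move: i; apply: (@iter_psum_inj (rk D)) => i.
by rewrite -hilb_nonface eq_psum_h sz_s0.
by move=> j; rewrite -sz_s0 eq_psum_h.
Qed.
End HPolynomial.

(** * Balanced complexes with a prescribed h-vector *)

(** For a fixed rank, the h-numbers are a unitriangular function of the f-numbers. *)
Lemma hnum_fnum_eq (V W : finType) (D : {set {set V}}) (D' : {set {set W}}) :
  rk D = rk D' -> hnum D =1 hnum D' -> fnum D =1 fnum D'.
Proof.
move=> eq_rk eq_h i; have [lt_i|] := ltnP (rk D) i.
  by rewrite !fnum_gt // -eq_rk.
have [k] := ubnP i; elim: k i => // k IHk i lt_i le_i.
have coef_term j : ('X^j * (1 - 'X) ^+ (rk D - j) : {poly int})`_i =
    if (i < j)%N then 0 else ((1 - 'X) ^+ (rk D - j) : {poly int})`_(i - j).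
  by rewrite coefXnM.
have hE (U : finType) (B : {set {set U}}) : rk B = rk D -> hnum B i = (fnum B i)%:Z
    + \sum_(j < (rk D).+1 | (j < i)%N) 
        (fnum B j)%:Z * ((1 - 'X) ^+ (rk D - j) : {poly int})`_(i - j).
  move=> eq_B; rewrite /hnum /hpoly eq_B coef_sum (bigID (fun j : 'I__ => (j < i)%N)) /= addrC.
  congr (_ + _); last first.
    apply: eq_bigr => j lt_j; rewrite coefZ coef_term ltnNge (ltnW lt_j) /=.
    by rewrite natz.
  rewrite (bigD1 (Ordinal (le_i : (i < (rk D).+1)%N))) ?ltnn //= big1 ?addr0.
    rewrite coefZ coef_term ltnn subnn -horner_coef0 !hornerE ?subr0 ?expr1n ?mulr1.
    by rewrite natz.
  move=> j /andP[le_j ne_j]; rewrite coefZ coef_term.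
  have -> : (i < j)%N; last by rewrite mulr0.
  by move: ne_j; rewrite -val_eqE /=; lia.
have := eq_h i; rewrite !hE // => eq_sum; apply/eqP; rewrite -eqz_nat; apply/eqP.
move: eq_sum; rewrite (eq_bigr (fun j : 'I_(rk D).+1 =>
  (fnum D' j)%:Z * ((1 - 'X) ^+ (rk D - j) : {poly int})`_(i - j))); first exact: addIr.
by move=> j lt_j; rewrite IHk //; lia.
Qed.

Lemma sum_powerset (R : comNzRingType) (T : finType) (C : {set T}) (x y : R) :
  \sum_(J in powerset C) x ^+ #|J| * y ^+ (#|C| - #|J|) = (x + y) ^+ #|C|.
Proof.
rewrite addrC exprDn (partition_big (fun J : {set T} => inord #|J| : 'I_#|C|.+1) xpredT) //=.
apply: eq_bigr => i _.
have eq_i J : J \in powerset C -> (inord #|J| == i :> 'I_#|C|.+1) = (#|J| == i :> nat).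
  by rewrite powersetE => /subset_leq_card ?; rewrite -val_eqE /= inordK.
rewrite (eq_bigr (fun _ => y ^+ (#|C| - i) * x ^+ i)); last first.
  by move=> J /andP[JC]; rewrite eq_i // => /eqP ->; rewrite mulrC.
rewrite sumr_const -cards_draws; congr (_ *+ _); apply: eq_card => J.
rewrite [RHS]inE -powersetE; apply: andb_id2l; exact: eq_i.
Qed.

Section Balancing.
Variables (V : finType) (d : nat) (S : {set {set V}}) (kappa : V -> 'I_d).
Hypothesis Scx : simplicial_complex S.
Hypothesis S0 : set0 \in S.
Hypothesis kappa_proper : proper_coloring S kappa.

Definition glue (p : {set V} * {set 'I_d}) : {set V + 'I_d} :=
  [set u | match u with inl v => v \in p.1 | inr j => j \in p.2 end].

Definition unglue (X : {set V + 'I_d}) : {set V} * {set 'I_d} :=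
  ([set v | inl v \in X], [set j | inr j \in X]).

Lemma glueK : cancel glue unglue.
Proof. by case=> F J; congr (_, _); apply/setP => u; rewrite !inE. Qed.

Lemma unglueK : cancel unglue glue.
Proof. by move=> X; apply/setP => -[v|j]; rewrite !inE. Qed.

Lemma card_glue p : #|glue p| = (#|p.1| + #|p.2|)%N.
Proof.
rewrite -(card_imset p.1 (@inl_inj V 'I_d)) -(card_imset p.2 (@inr_inj V 'I_d)).
have -> : glue p = (inl @: p.1) :|: (inr @: p.2).
  apply/setP => -[v|j]; rewrite !inE.
    rewrite mem_imset; last exact: inl_inj.
    by rewrite (_ : _ \in inr @: _ = false) ?orbF //; apply/imsetP => -[].
  rewrite (_ : _ \in inl @: _ = false); last by apply/imsetP => -[].
  by rewrite mem_imset //; exact: inr_inj.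
rewrite cardsU; have -> : inl @: p.1 :&: inr @: p.2 = set0 :> {set V + 'I_d}.
  by apply/setP => u; rewrite !inE; apply/andP => -[/imsetP[v _ ->] /imsetP[]].
by rewrite cards0 subn0.
Qed.

(* The union over F in S of the simplices on F and the colors missing from F. *)
Definition balanced_hull : {set {set V + 'I_d}} :=
  [set X | ((unglue X).1 \in S) && ((unglue X).2 \subset ~: kappa @: (unglue X).1)].

Lemma balanced_hull_cx : simplicial_complex balanced_hull.
Proof.
move=> X Y; rewrite !inE /= => /andP[XS XJ] /subsetP YX.
have YX1 : [set v | inl v \in Y] \subset [set v | inl v \in X].
  by apply/subsetP => v; rewrite !inE => /YX.
rewrite (Scx XS) //=; apply/subsetP => j; rewrite inE => /YX jX.
have := subsetP XJ j; rewrite !inE => /(_ jX); apply: contra.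
exact/subsetP/imsetS.
Qed.

Definition hull_color (u : V + 'I_d) : 'I_d := match u with inl v => kappa v | inr j => j end.

Lemma hull_color_proper : proper_coloring balanced_hull hull_color.
Proof.
move=> X u w; rewrite inE => /andP[XS /subsetP XJ].
have cross v j : inl v \in X -> inr j \in X -> kappa v != j.
  move=> vX jX; apply: contraTneq (XJ j _) => [<-|]; last by rewrite inE.
  by rewrite inE negbK imset_f // inE.
case: u w => [v|j] [w|j'] uX wX /= ne_uw.
- by apply: (kappa_proper XS); rewrite ?inE //; apply: contra_neq ne_uw => ->.
- exact: cross.
- by rewrite eq_sym cross.
- by apply: contra_neq ne_uw => ->.
Qed.

(** Colors are injective on faces, which gives the upper bound; the simplex on all colors, lying
    over the empty face, attains it. *)
Lemma rk_balanced_hull : rk balanced_hull = d.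
Proof.
apply/eqP; rewrite eqn_leq; apply/andP; split.
  apply/bigmax_leqP => X XD; rewrite -[leqRHS]card_ord.
  rewrite -(card_in_imset (f := hull_color)) ?max_card // => u w uX wX.
  by move/eqP; apply: contraTeq; apply: hull_color_proper XD uX wX.
have card_T : #|glue (set0, setT)| = d by rewrite card_glue cards0 cardsT card_ord.
by rewrite -[leqLHS]card_T card_le_rk // inE glueK S0 /= imset0 setC0 subxx.
Qed.

(** If C is the set of colors missing from F, the faces lying over F contribute X^|F| times (X + (1
    - X))^|C|, that is, X^|F|. *)
Lemma hnum_balanced_hull i : hnum balanced_hull i = (fnum S i)%:Z.
Proof.
have -> : (fnum S i)%:Z = (\sum_(F in S) 'X^#|F| : {poly int})`_i.
  rewrite coef_sum /fnum -sum1dep_card big_mkcondr /= -natz natr_sum.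
  by apply: eq_bigr => F _; rewrite coefXn eq_sym; case: eqP.
congr (nth 0 (polyseq _) i); rewrite hpolyE rk_balanced_hull.
rewrite (reindex glue) /=; last by exists unglue => ? _; rewrite ?glueK ?unglueK.
transitivity (\sum_(F in S) \sum_(J in powerset (~: kappa @: F))
  ('X^#|glue (F, J)| * (1 - 'X) ^+ (d - #|glue (F, J)|)) : {poly int}).
  rewrite pair_big_dep /=; apply: eq_big => [[F J]|[F J] _] //.
  by rewrite inE glueK powersetE.
apply: eq_bigr => F FS; pose C := ~: kappa @: F.
have card_C : (#|C| + #|F| = d)%N.
  rewrite addnC -(card_in_imset (f := kappa)) ?cardsC ?card_ord // => v w vF wF.
  by move/eqP; apply: contraTeq; apply: kappa_proper FS vF wF.
rewrite (eq_bigr (fun J : {set _} => 'X^#|F| * ('X^#|J| * (1 - 'X) ^+ (#|C| - #|J|)))).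
  by rewrite -mulr_sumr sum_powerset addrC subrK expr1n mulr1.
move=> J _; rewrite card_glue /= exprD -mulrA; congr (_ * (_ * _ ^+ _)).
by move: card_C; move: #|F| #|C| #|J| => f c j <-; rewrite addnC subnDl.
Qed.

End Balancing.

(** * Parameters of almost bipartite factors *)

Definition indic (K : fieldType) (V : finType) (T : {set V}) : {ffun V -> K} :=
  [ffun v => (v \in T)%:R].

Section Relations.
Variables (K : fieldType) (V : finType) (wt : V -> nat) (D : {set {set V}}).
Variable s : seq {ffun V -> K}.
Implicit Types (T : {set V}) (m : 'X_{1..#|V|}).

Local Notation U := (ext (@lop K V) (nonface K D) s).
Local Notation std := (standard wt U).

Lemma sum_indic T (E : lmodType K) (F : V -> E) :
  \sum_v indic K T v *: F v = \sum_(v in T) F v.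
Proof.
rewrite [RHS]big_mkcond; apply: eq_bigr => v _; rewrite ffunE.
by case: (v \in T); rewrite ?scale1r ?scale0r.
Qed.

Lemma nonface_nonstandard m : msup m \notin D -> ~~ std m.
Proof.
move=> mD; rewrite negbK; apply/(subvP (addvSl _ _))/(subvP (sub_ext _ _ _ _)).
exact: monf_nonface.
Qed.

(** The sum of the products of m with the variables of T lies in U, so the term of v is, modulo U,
    minus the sum of the others. *)
Lemma relation_mem T v m (W : {vspace form K #|V| (mdeg m).+1}) :
    indic K T \in s -> v \in T ->
    (forall u, u \in T -> u != v ->
       monf K (mdeg m).+1 (mvar u + m)%MM \in (U (mdeg m).+1 + W)%VS) ->
  monf K (mdeg m).+1 (mvar v + m)%MM \in (U (mdeg m).+1 + W)%VS.
Proof.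
move=> T_s vT mem_u.
have rel : \sum_(u in T) monf K (mdeg m).+1 (mvar u + m)%MM \in U (mdeg m).+1.
  rewrite -sum_indic -lop_monf //= (big_rem _ T_s) /=.
  by apply/(subvP (addvSr _ _))/(subvP (addvSl _ _)); rewrite memv_img ?memvf.
rewrite (bigD1 v) //= in rel.
rewrite -[monf K _ (mvar v + m)%MM](addrK (\sum_(u in T | u != v) monf K _ (mvar u + m)%MM)).
rewrite memvB //; first exact: (subvP (addvSl _ _)) rel.
by apply: memv_suml => u /andP[uT ne_uv]; apply: mem_u.
Qed.

Lemma relation_nonstandard T v m : indic K T \in s -> v \in T ->
    (forall u, u \in T -> u != v ->
       monf K (mdeg m).+1 (mvar u + m)%MM
         \in (U (mdeg m).+1 + smaller K wt (mdeg m).+1 (mvar v + m)%MM)%VS) ->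
  ~~ std (mvar v + m)%MM.
Proof.
by move=> T_s vT mem_u; rewrite negbK mdegD mdeg_mvar add1n (relation_mem T_s).
Qed.

Lemma mem_of_nonface i m (W : {vspace form K #|V| i}) : mdeg m = i -> msup m \notin D ->
  monf K i m \in (U i + W)%VS.
Proof.
move=> deg_m mD; apply/(subvP (addvSl _ _))/(subvP (sub_ext _ _ _ _)).
exact: monf_nonface.
Qed.

Lemma mem_of_smaller i m m' (W : {vspace form K #|V| i}) : mdeg m' = i -> mlt wt m' m ->
  monf K i m' \in (W + smaller K wt i m)%VS.
Proof. by move=> deg_m' lt_m'; apply/(subvP (addvSr _ _))/mem_smaller. Qed.

End Relations.

Section Factors.
Variables (K : fieldType) (V : finType).
Implicit Types (D G : {set {set V}}) (e F : {set V}).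

(** The part of [face_spanning] that concerns one factor; p may be nonzero off its vertices. The
    blocks [T c] may overlap, as A and B + a' do. *)
Definition spanning_partition G r (T : nat -> {set V}) : Prop :=
  forall p : {ffun V -> K}, [set v in vertices G | p v != 0] \in G ->
    (forall c, (c < r)%N -> \sum_(v in T c) p v = 0) ->
  forall v, v \in vertices G -> p v = 0.

(** Quantifying over D, s and wt' makes the property usable inside a join, where the complex, the
    parameters and the weights also involve other factors. *)
Definition rainbow_standard G r (kappa : V -> nat) (T : nat -> {set V}) (wt : V -> nat) : Prop :=
  forall D (s : seq {ffun V -> K}) (wt' : V -> nat),
    simplicial_complex D ->
    (forall F, F \in D -> F :&: vertices G \in G) ->
    (forall c, (c < r)%N -> indic K (T c) \in s) ->
    {in vertices G, wt' =1 wt} ->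
  forall v w, v \in vertices G -> w \in vertices G -> kappa v = kappa w ->
    ~~ standard wt' (ext (@lop K V) (nonface K D) s) (mvar v + mvar w)%MM.

Definition tame G r (kappa : V -> nat) (T : nat -> {set V}) (wt : V -> nat) : Prop :=
  [/\ forall v, (kappa v < r)%N, spanning_partition G r T & rainbow_standard G r kappa T wt].

Lemma setI_pair (A : {set V}) v w : v \in A -> w \in A -> [set v; w] :&: A = [set v; w].
Proof. by move=> vA wA; apply/setIidPl; rewrite subUset !sub1set vA wA. Qed.

(** A face meets each color class at most once, so the class sums span. Multiplying the sum over the
    class of v by the variable of v leaves only its square, since the other products are
    nonfaces. *)
Lemma tame_proper G r (kappa : V -> 'I_r) : proper_coloring G kappa ->
  tame G r kappa (fun c => [set v in vertices G | kappa v == c :> nat]) (fun _ => 0%N).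
Proof.
move=> kappaP; split=> [v|p pG p_T v vG|D s wt' Dcx DG T_s _ v w vG wG eq_vw].
- exact: ltn_ord.
- apply/eqP; apply: contraT => p_v.
  have vT : v \in [set u in vertices G | kappa u == kappa v :> nat] by rewrite inE vG eqxx.
  have := p_T _ (ltn_ord (kappa v)); rewrite (bigD1 v) //= big1 => [/eqP|].
    by rewrite addr0 (negPf p_v).
  move=> u /andP[]; rewrite inE => /andP[uG /eqP/val_inj eq_uv] ne_uv.
  apply/eqP; apply: contraT => p_u.
  have pF w : w \in vertices G -> p w != 0 -> w \in [set v in vertices G | p v != 0].
    by move=> wG p_w; rewrite inE wG.
  by have := kappaP _ u v pG (pF u uG p_u) (pF v vG p_v) ne_uv; rewrite eq_uv eqxx.
have no_edge u : u \in vertices G -> kappa u = kappa v -> u != v -> [set u; v] \notin D.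
  move=> uG eq_uv ne_uv; apply/negP => /DG; rewrite setI_pair // => uvG.
  by have := kappaP _ u v uvG; rewrite set21 set22 eq_uv eqxx => /(_ isT isT ne_uv).
have [<-|ne_vw] := eqVneq v w; last first.
  rewrite nonface_nonstandard // msupD !msup_mvar setUC no_edge //; last by rewrite eq_sym.
  by apply: val_inj; rewrite /= eq_vw.
apply: (relation_nonstandard (T_s _ (ltn_ord (kappa v)))); first by rewrite inE vG eqxx.
move=> u; rewrite inE => /andP[uG /eqP/val_inj eq_uv] ne_uv.
by rewrite mem_of_nonface ?mdegD ?mdeg_mvar // msupD !msup_mvar no_edge.
Qed.

Lemma tame_almost_bipartite G a a' (kappa : V -> 'I_2) :
    simplicial_complex G -> flag G -> rk G = 2%N -> a != a' -> [set a; a'] \in G ->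
    proper_coloring (G :\ [set a; a']) kappa -> kappa a = kappa a' ->
  exists T wt, tame G 2 kappa T wt.
Proof.
move=> Gcx Gflag rkG ne_aa' eG kappaP eq_aa'.
have [aG a'G] : a \in vertices G /\ a' \in vertices G.
  by rewrite !inE !(Gcx _ _ eG) ?sub1set ?set21 ?set22.
pose T c := [set v in vertices G | kappa v == c :> nat]
              :|: (if c == kappa a then set0 else [set a']).
(* These weights realize x_a > x_a' > B > A - {a, a'}, where A is the color class of a, also
   containing a', and B is the other class. *)
pose wt v := if v == a then 3%N
  else if v == a' then 2%N else if kappa v == kappa a then 0%N else 1%N.
have edge_color u v : [set u; v] \in G -> u != v -> kappa u = kappa v -> [set u; v] = [set a; a'].
  move=> uvG ne_uv eq_uv; apply/eqP; apply: contraT => ne_e.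
  have uvG' : [set u; v] \in G :\ [set a; a'] by rewrite in_setD1 ne_e.
  by have := kappaP _ u v uvG'; rewrite set21 set22 ne_uv eq_uv eqxx => /(_ isT isT isT).
have T_A v : (v \in T (kappa a)) = (v \in vertices G) && (kappa v == kappa a).
  by rewrite /T eqxx setU0 inE.
have T_B v (c : nat) : c != kappa a -> (v \in T c) =
    (v == a') || (v \in vertices G) && (kappa v == c :> nat).
  by move=> /negPf ne_c; rewrite /T ne_c !inE orbC.
pose b := (1 - kappa a)%N.
have [lt_b ne_b] : (b < 2)%N /\ b != kappa a by rewrite /b; have := ltn_ord (kappa a); lia.
have kappa_b v : kappa v != kappa a -> kappa v = b :> nat.
  by rewrite -val_eqE /b /=; have := ltn_ord (kappa v); have := ltn_ord (kappa a); lia.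
have le2 F : F \in G -> (#|F| <= 2)%N by rewrite -rkG; apply: card_le_rk.
have card_e : #|[set a; a']| = 2%N by rewrite cards2 ne_aa'.
exists T, wt; split=> [v|p pG p_T v vG|D s wt' Dcx DG T_s eq_wt v w vG wG eq_vw].
- exact: ltn_ord.
- set F0 := [set v in vertices G | p v != 0] in pG.
  have memF u : u \in vertices G -> p u != 0 -> u \in F0 by move=> uG p_u; rewrite inE uG.
  have F0_color u w : u \in vertices G -> p w != 0 -> w \in vertices G -> F0 != [set a; a'] ->
      kappa u = kappa w -> u != w -> p u = 0.
    move=> uG p_w wG ne_e eq_uw ne_uw; apply/eqP; apply: contraT => p_u.
    have F0G : F0 \in G :\ [set a; a'] by rewrite in_setD1 ne_e.
    by have := kappaP _ u w F0G (memF u uG p_u) (memF w wG p_w) ne_uw; rewrite eq_uw eqxx.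
  (* If p were supported exactly on the deleted edge, its sum over B + a' would reduce to the
     nonzero value p a'. *)
  have ne_e : F0 != [set a; a'].
    apply/eqP => F0_e; have : p a' != 0.
      by have : a' \in F0 by [rewrite F0_e set22]; rewrite inE => /andP[].
    have a'T : a' \in T b by rewrite T_B ?eqxx.
    have := p_T b lt_b; rewrite (bigD1 a') //= big1 => [|u /andP[]].
      by rewrite addr0 => ->; rewrite eqxx.
    rewrite T_B // => /orP[->//|/andP[uG /eqP u_b] _].
    apply/eqP; apply: contraT => /(memF u uG); rewrite F0_e !inE.
    by case/orP=> /eqP u_a; move: u_b ne_b; rewrite u_a -?eq_aa' => ->; rewrite eqxx.
  (* The support is now a face without the deleted edge, so it meets each color class at most once.
     The sum over A shows that p vanishes on A, in particular at a', and the other sum then handles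
     B. *)
  have p_A u : u \in vertices G -> kappa u = kappa a -> p u = 0.
    move=> uG u_A; apply/eqP; apply: contraT => p_u.
    have uT : u \in T (kappa a) by rewrite T_A uG u_A eqxx.
    have := p_T (kappa a) (ltn_ord _); rewrite (bigD1 u) //= big1 => [|w /andP[]].
      by rewrite addr0 => p_u0; rewrite p_u0 eqxx in p_u.
    rewrite T_A => /andP[wG /eqP w_A] ne_wu.
    by apply: (F0_color w u); rewrite // w_A u_A.
  have [v_A|v_B] := eqVneq (kappa v) (kappa a); first exact: p_A.
  apply/eqP; apply: contraT => p_v.
  have vT : v \in T b by rewrite T_B // vG kappa_b ?eqxx ?orbT.
  have := p_T b lt_b; rewrite (bigD1 v) //= big1 => [|w /andP[]].
    by rewrite addr0 => p_v0; rewrite p_v0 eqxx in p_v.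
  rewrite T_B // => /orP[/eqP -> _|/andP[wG /eqP w_B] ne_wv]; first exact: p_A.
  by apply: (F0_color w v) => //; apply: val_inj; rewrite /= w_B kappa_b.
set U := ext _ _ _; have stU : stable (@lop K V) U.
  by apply: stable_ext; [exact: lopC | exact: stable_nonface].
have wt'E u : u \in vertices G -> mweight wt' (mvar u) = wt u.
  by move=> uG; rewrite mweight_mvar eq_wt.
have TG c u : u \in T c -> u \in vertices G.
  rewrite /T in_setU in_set; case/orP=> [/andP[] //|].
  by case: ifP; rewrite ?in_set0 // in_set1 => _ /eqP ->.
have var_a : ~~ standard wt' U (mvar a).
  rewrite -[mvar a]addm0; apply: (relation_nonstandard (T_s _ (ltn_ord (kappa a)))).
    by rewrite T_A aG eqxx.
  move=> u uT ne_u; have uG := TG _ _ uT; apply: mem_of_smaller.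
    by rewrite mdegD mdeg_mvar mdeg0.
  by rewrite !addm0 /mlt !wt'E // /wt eqxx (negPf ne_u); case: (u == a'); case: (_ == _).
have var_a' : ~~ standard wt' U (mvar a').
  rewrite -[mvar a']addm0; apply: (relation_nonstandard (T_s b lt_b)).
    by rewrite T_B ?eqxx.
  move=> u uT ne_u; have uG := TG _ _ uT; apply: mem_of_smaller.
    by rewrite mdegD mdeg_mvar mdeg0.
  move: uT; rewrite T_B // (negPf ne_u) /= => /andP[_ /eqP u_b].
  have u_nA : kappa u != kappa a by rewrite -val_eqE /= u_b.
  have u_na : u != a by apply: contraNneq u_nA => ->.
  rewrite !addm0 /mlt !wt'E // /wt eqxx (negPf ne_u) (negPf u_na) (negPf u_nA).
  by rewrite [a' == a]eq_sym (negPf ne_aa').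
have var_e u : u \in [set a; a'] -> ~~ standard wt' U (mvar u).
  by rewrite !inE => /orP[] /eqP ->.
have [v_e|v_e] := boolP (v \in [set a; a']).
  by apply: contra (var_e v v_e); rewrite addmC; apply: standardD.
have [w_e|w_e] := boolP (w \in [set a; a']).
  by apply: contra (var_e w w_e); apply: standardD.
have no_edge u t : u \in vertices G -> t \in vertices G -> t \notin [set a; a'] ->
    kappa u = kappa t -> u != t -> [set u; t] \notin D.
  move=> uG tG t_e eq_ut ne_ut; apply: contra t_e => /DG; rewrite setI_pair // => utG.
  by rewrite -(edge_color u t) ?set22.
have [eq_v|ne_vw] := eqVneq v w; last first.
  rewrite nonface_nonstandard // msupD !msup_mvar no_edge //.
  exact: val_inj.
subst w; have {eq_vw w_e wG} lop_v u : u \in vertices G -> kappa u = kappa v -> u != v ->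
    monf K (mdeg (mvar v)).+1 (mvar u + mvar v)%MM
      \in (U (mdeg (mvar v)).+1 + smaller K wt' (mdeg (mvar v)).+1 (mvar v + mvar v)%MM)%VS.
  move=> uG eq_uv ne_uv; rewrite mem_of_nonface ?mdegD ?mdeg_mvar //.
  by rewrite msupD !msup_mvar no_edge.
have [v_A|v_B] := eqVneq (kappa v) (kappa a).
  apply: (relation_nonstandard (T_s _ (ltn_ord (kappa a)))); first by rewrite T_A vG v_A eqxx.
  by move=> u; rewrite T_A => /andP[uG /eqP u_A] ne_uv; apply: lop_v; rewrite ?u_A.
apply: (relation_nonstandard (T_s b lt_b)); first by rewrite T_B // vG kappa_b ?eqxx ?orbT.
move=> u; rewrite T_B // => /orP[/eqP -> ne_v|/andP[uG /eqP u_b] ne_uv]; last first.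
  by apply: lop_v => //; apply: val_inj; rewrite /= u_b kappa_b.
have [a'vD|a'vD] := boolP ([set a'; v] \in D); last first.
  by rewrite mem_of_nonface ?mdegD ?mdeg_mvar // msupD !msup_mvar.
(* As G has no triangle, [x_a x_v = 0], and the relation for the color of a rewrites
   [x_a' x_v] in terms of smaller monomials. *)
apply: (relation_mem (T_s _ (ltn_ord (kappa a)))); first by rewrite T_A a'G eq_aa' eqxx.
move=> t; rewrite T_A => /andP[tG /eqP t_A] ne_ta'.
have [->|ne_ta] := eqVneq t a.
  rewrite mem_of_nonface ?mdegD ?mdeg_mvar // msupD !msup_mvar.
  apply/negP => /DG; rewrite setI_pair // => avG.
  have a'vG : [set a'; v] \in G by rewrite -(setI_pair a'G vG) DG.
  have := le2 [set a; a'; v]; rewrite setUC cardsU1 v_e card_e.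
  suff -> : v |: [set a; a'] \in G by move=> /(_ isT).
  apply: Gflag => x y; rewrite !inE.
  move: vG aG a'G; rewrite !inE => vG aG a'G.
  by case/or3P=> /eqP ->; case/or3P=> /eqP ->; rewrite ?setUid // setUC.
apply: mem_of_smaller; rewrite ?mdegD ?mdeg_mvar //.
rewrite /mlt !mweightD !wt'E // /wt; move: v_e; rewrite !inE negb_or => /andP[/negPf -> /negPf ->].
by rewrite (negPf ne_ta) (negPf ne_ta') t_A eqxx (negPf v_B).
Qed.
End Factors.

(** In rank 1 a single color suffices. In rank 2, if the coloring of G minus e separates the ends of
    e, it is already proper on G; otherwise [tame_almost_bipartite] applies. *)
Lemma factor_tame (K : fieldType) (V : finType) (G : {set {set V}}) :
    simplicial_complex G -> cdim G = 0 \/ cdim G = 1 -> flag G ->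
    bipartite G \/ (exists e : {set V}, is_edge G e /\ bipartite (G :\ e)) ->
  exists kappa T wt, tame K G (rk G) kappa T wt.
Proof.
move=> Gcx Gdim Gflag Gbip.
have rkG : rk G = 1%N \/ rk G = 2%N by rewrite /cdim in Gdim; lia.
have [rk1|rk2] := rkG.
  rewrite rk1; exists (fun _ => 0%N); do 2 eexists.
  apply: (tame_proper _ (kappa := fun _ => ord0 : 'I_1)) => F u v FG uF vF ne_uv.
  have := card_le_rk FG; rewrite rk1 leqNgt => /negP[].
  by rewrite -[2%N]/(true.+1) -ne_uv -cards2 subset_leq_card // subUset !sub1set uF vF.
rewrite rk2.
have [[kappa kappaP]|[e [[eG /eqP/cards2P[a [a' [ne_aa' def_e]]]] [kappa kappaP]]]] := Gbip.
  by exists kappa; do 2 eexists; apply: (tame_proper _ kappaP).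
have [eq_aa'|ne_col] := eqVneq (kappa a) (kappa a').
  rewrite def_e in eG kappaP.
  have [T [wt tameG]] := tame_almost_bipartite K Gcx Gflag rk2 ne_aa' eG kappaP eq_aa'.
  by exists kappa, T, wt.
exists kappa; do 2 eexists; apply: (tame_proper _ (kappa := kappa)) => F u v FG uF vF ne_uv.
have [eq_F|ne_F] := eqVneq F e; last by apply: (kappaP F) => //; rewrite in_setD1 ne_F.
move: uF vF; rewrite eq_F def_e !inE.
case/orP=> /eqP eq_u; case/orP=> /eqP eq_v; move: ne_uv; rewrite eq_u eq_v ?eqxx //.
by move=> _; rewrite eq_sym.
Qed.

Lemma hnum0 (V : finType) (D : {set {set V}}) : set0 \in D -> hnum D 0 = 1.
Proof.
move=> D0; rewrite /hnum -horner_coef0 hpolyE horner_sum (bigD1 set0) //= big1.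
  by rewrite cards0 !hornerE /= ?subr0 ?expr1n ?mulr1 ?addr0.
move=> F /andP[_ F0]; rewrite hornerM hornerXn expr0n cards_eq0 (negPf F0).
by rewrite mul0r.
Qed.

(** * Faces and ranks of joins *)

Section Join.
Variables (V : finType) (k : nat) (Gamma : 'I_k -> {set {set V}}).
Hypothesis Gamma_cx : forall i, simplicial_complex (Gamma i).
Hypothesis Gamma_disj : forall i j, i != j ->
  [disjoint vertices (Gamma i) & vertices (Gamma j)].

Lemma face_vertices (G : {set {set V}}) F v :
  simplicial_complex G -> F \in G -> v \in F -> v \in vertices G.
Proof. by move=> Gcx FG vF; rewrite inE (Gcx F) ?sub1set. Qed.

Lemma vertices_disj i j v :
  v \in vertices (Gamma i) -> v \in vertices (Gamma j) -> i = j.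
Proof.
move=> vi vj; apply/eqP; apply: contraT => /Gamma_disj /pred0P /(_ v) /=.
by rewrite vi vj.
Qed.

(** As the vertex sets are disjoint, intersecting with the vertices of a factor recovers the
    component of a face in that factor. *)
Lemma join_face (r : seq 'I_k) F : uniq r ->
    F \in \big[@sjoin V/[set set0]]_(i <- r) Gamma i ->
  (forall i, i \in r -> F :&: vertices (Gamma i) \in Gamma i) /\
  (forall v, v \in F -> exists2 i, i \in r & v \in vertices (Gamma i)).
Proof.
elim: r F => [|j r IHr] F /=.
  by rewrite big_nil inE => _ /eqP ->; split=> // v; rewrite inE.
case/andP=> j_r uniq_r; rewrite big_cons => /imset2P[A B AG /(IHr _ uniq_r)[BG B_v] ->].
split=> [i|v]; last first.
  rewrite inE => /orP[vA|/B_v[i i_r vi]]; last by exists i; rewrite // inE i_r orbT.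
  by exists j; rewrite ?mem_head // (face_vertices _ AG).
rewrite inE => /orP[/eqP ->|i_r].
  rewrite (_ : _ :&: _ = A) //; apply/setP => v; rewrite in_setI in_setU.
  apply/andP/idP => [[/orP[//|/B_v[i' i_r vi]] vj]|vA].
    by rewrite -(vertices_disj vi vj) i_r in j_r.
  by rewrite vA (face_vertices _ AG).
rewrite (_ : _ :&: _ = B :&: vertices (Gamma i)); first exact: BG.
rewrite setIUl (_ : A :&: _ = set0) ?set0U //; apply/setP => v; rewrite in_setI in_set0.
apply/negP => /andP[vA vi]; have vj := face_vertices (@Gamma_cx j) AG vA.
by rewrite -(vertices_disj vi vj) i_r in j_r.
Qed.

Lemma max_face (G : {set {set V}}) : (0 < rk G)%N -> exists2 F, F \in G & #|F| = rk G.
Proof.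
move=> rk_gt0; have G_gt0 : (0 < #|G|)%N.
  rewrite lt0n; apply: contraTN rk_gt0 => /eqP/cards0_eq ->.
  by rewrite /rk big_set0.
rewrite /rk; have [F FG ->] := eq_bigmax_cond (fun F : {set V} => #|F|) G_gt0.
by exists F.
Qed.

Lemma rk_join (r : seq 'I_k) : uniq r -> (forall i, 0 < rk (Gamma i))%N ->
  rk (\big[@sjoin V/[set set0]]_(i <- r) Gamma i) = (\sum_(i <- r) rk (Gamma i))%N.
Proof.
move=> uniq_r rk_gt0.
suff [F FG max_F] : exists2 F, F \in \big[@sjoin V/[set set0]]_(i <- r) Gamma i
    & #|F| = (\sum_(i <- r) rk (Gamma i))%N.
  apply/eqP; rewrite eqn_leq -{2}max_F card_le_rk // andbT.
  apply/bigmax_leqP => {F FG max_F}; elim: r {uniq_r} => [|j r IHr] F.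
    by rewrite !big_nil inE => /eqP ->; rewrite cards0.
  rewrite !big_cons => /imset2P[A B AG BG ->]; rewrite cardsU.
  by rewrite (leq_trans (leq_subr _ _)) // leq_add ?card_le_rk ?IHr.
elim: r uniq_r => [|j r IHr] /=.
  by rewrite !big_nil; exists set0; rewrite ?cards0 // inE.
case/andP=> j_r uniq_r; have [B BG card_B] := IHr uniq_r.
have [A AG card_A] := max_face (rk_gt0 j).
exists (A :|: B); first by rewrite big_cons imset2_f.
rewrite big_cons -card_A -card_B cardsU (_ : A :&: B = set0) ?cards0 ?subn0 //.
apply/setP => v; rewrite in_setI in_set0; apply/negP => /andP[vA vB].
have [i i_r vi] := (join_face uniq_r BG).2 v vB.
by rewrite (vertices_disj (face_vertices (@Gamma_cx j) AG vA) vi) i_r in j_r.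
Qed.

End Join.

(** * Assembling the factors *)

Theorem theorem1p2 (K : fieldType) (charK : [pchar K] =i pred0)
    (k : nat) (k_gt0 : (0 < k)%N) (V : finType)
    (Gamma : 'I_k -> {set {set V}})
    (Gamma_cx : forall i, simplicial_complex (Gamma i))
    (Gamma_disj : forall i j, i != j ->
       [disjoint vertices (Gamma i) & vertices (Gamma j)])
    (Gamma_dim : forall i, cdim (Gamma i) = 0 \/ cdim (Gamma i) = 1)
    (Gamma_flag : forall i, flag (Gamma i))
    (Gamma_bip : forall i, bipartite (Gamma i) \/
       exists e : {set V}, is_edge (Gamma i) e /\ bipartite (Gamma i :\ e))
    (Delta : {set {set V}}) :
  full_dim_subcomplex Delta (\big[@sjoin V/[set set0]]_(i < k) Gamma i) ->
  cohen_macaulay K Delta ->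
  exists (W : finType) (Delta' : {set {set W}}),
    [/\ simplicial_complex Delta', balanced Delta',
        cdim Delta' = cdim Delta & fvector Delta' = fvector Delta].
Proof.
move=> [Dcx sub_D eq_dim] cmD; pose r i := rk (Gamma i).
have r_gt0 i : (0 < r i)%N by rewrite /r; have := Gamma_dim i; rewrite /cdim; lia.
have uniq_k := index_enum_uniq 'I_k.
have rkD : rk Delta = (\sum_i r i)%N.
  move: eq_dim; rewrite /cdim => /addIr[->].
  exact: (rk_join Gamma_cx Gamma_disj uniq_k r_gt0).
have rkD_gt0 : (0 < rk Delta)%N by rewrite rkD (bigD1 (Ordinal k_gt0)) //= addn_gt0 r_gt0.
have DG F i : F \in Delta -> F :&: vertices (Gamma i) \in Gamma i.
  move/(subsetP sub_D)/(join_face Gamma_cx Gamma_disj uniq_k) => [+ _]; apply.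
  exact: mem_index_enum.
have D_v F v : F \in Delta -> v \in F -> exists i, v \in vertices (Gamma i).
  move/(subsetP sub_D)/(join_face Gamma_cx Gamma_disj uniq_k) => [_ FV] /FV[i _ vi].
  by exists i.
have [f tame_f] : exists f : 'I_k -> (V -> nat) * (nat -> {set V}) * (V -> nat),
    forall i, tame K (Gamma i) (r i) (f i).1.1 (f i).1.2 (f i).2.
  apply: (@fin_all_exists _ _ (fun i (x : (V -> nat) * (nat -> {set V}) * (V -> nat)) =>
    tame K (Gamma i) (r i) x.1.1 x.1.2 x.2)) => i.
  have [kappa [T [wt tame_i]]] :=
    factor_tame K (Gamma_cx i) (Gamma_dim i) (Gamma_flag i) (Gamma_bip i).
  by exists (kappa, T, wt).
(* The colors of the join are the pairs of a factor and one of its colors; positions in this list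
   number them below [rk Delta]. *)
pose colors := [seq (i, c) | i <- enum 'I_k, c <- iota 0 (r i)].
have size_colors : size colors = rk Delta.
  rewrite size_allpairs_dep rkD sumnE big_map big_enum /=.
  by apply: eq_bigr => i _; rewrite size_iota.
have mem_colors i c : ((i, c) \in colors) = (c < r i)%N.
  apply/allpairsPdep/idP => [[j [c' [_ + [-> ->]]]]|lt_c]; first by rewrite mem_iota.
  by exists i, c; rewrite mem_enum mem_iota.
pose s := [seq indic K ((f ic.1).1.2 ic.2) | ic <- colors].
(* Points in no factor get color 0, which is available because [rk Delta] is positive, and weight
   0. *)
pose part v : option 'I_k := [pick i | v \in vertices (Gamma i)].
have partE v i : v \in vertices (Gamma i) -> part v = Some i.
  move=> vi; rewrite /part; case: pickP => [j vj|/(_ i)]; last by rewrite vi.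
  by rewrite (vertices_disj Gamma_disj vi vj).
pose color v := if part v is Some i then index (i, (f i).1.1 v) colors else 0%N.
pose wt v := if part v is Some i then (f i).2 v else 0%N.
have lt_color v : (color v < rk Delta)%N.
  rewrite /color; case: (part v) => // i; rewrite -size_colors index_mem mem_colors.
  by case: (tame_f i).
pose kappa v : 'I_(rk Delta) := Ordinal (lt_color v).
pose U := ext (@lop K V) (nonface K Delta) s.
have stU : stable (@lop K V) U.
  by apply: stable_ext; [exact: lopC | exact: stable_nonface].
have s_mem i c : (c < r i)%N -> indic K ((f i).1.2 c) \in s.
  move=> lt_c; apply: (map_f (fun ic => indic K ((f ic.1).1.2 ic.2)) (_ : (i, c) \in colors)).
  by rewrite mem_colors.
have s_span : face_spanning Delta s.
  move=> p pD p_s; apply/ffunP => v; rewrite ffunE; apply/eqP; apply: contraT => p_v.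
  have [|i vi] := D_v _ v pD; first by rewrite inE.
  have [_ span_i _] := tame_f i; case/eqP: p_v; apply: (span_i p) => // [|c lt_c].
    have -> : [set u in vertices (Gamma i) | p u != 0] = [set u | p u != 0] :&: vertices (Gamma i).
      by apply/setP => u; rewrite in_setI !in_set andbC.
    exact: DG.
  rewrite -[RHS](p_s _ (s_mem i c lt_c)) big_mkcond; apply: eq_bigr => u _.
  by rewrite ffunE; case: (u \in _); rewrite ?mul1r ?mul0r.
(* If the product were standard, both variables would be too, so v and w would be vertices of Delta
   and lie in factors. Equal colors put them in the same factor, where [rainbow_standard]
   applies. *)
have kappa_std v w : kappa v = kappa w -> ~~ standard wt U (mvar v + mvar w)%MM.
  move/(congr1 val); rewrite /= /color.
  have std_part u : standard wt U (mvar u) -> exists i, u \in vertices (Gamma i).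
    move=> u_std; have uD : msup (mvar u) \in Delta.
      by apply: contraTT u_std; apply: nonface_nonstandard.
    by apply: (D_v _ _ uD); rewrite msup_mvar set11.
  move=> eq_c; apply/negP => vw_std.
  have [j wj] := std_part w (standardD stU vw_std).
  have [i vi] : exists i, v \in vertices (Gamma i).
    by apply: std_part; apply: (standardD stU (m := mvar w)); rewrite addmC.
  move: eq_c; rewrite (partE v i vi) (partE w j wj) => eq_c.
  have [lt_i _ std_i] := tame_f i; have [lt_j _ _] := tame_f j.
  have [eq_ij eq_f] : (i, (f i).1.1 v) = (j, (f j).1.1 w).
    by apply: (index_inj (i, 0%N) _ _ eq_c); rewrite mem_colors.
  subst j; move: vw_std; apply/negP; apply: std_i => // [F|c|u ui]; [exact: DG|exact: s_mem|].
  by rewrite /wt (partE u i ui).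
pose S := standard_faces wt U.
have Scx : simplicial_complex S by apply: standard_faces_cx.
have hS i : (fnum S i)%:Z = hnum Delta i.
  rewrite (fnum_standard_faces stU kappa_std).
  by apply: cohen_macaulay_hilb; rewrite // size_map.
have kappaP : proper_coloring S kappa.
  by move=> F u v; apply: (standard_faces_rainbow stU kappa_std).
(* Since h_0 = 1, the complex S has a face with no vertices. *)
have S0 : set0 \in S.
  have D0 : set0 \in Delta.
    by have [F FD _] := max_face rkD_gt0; rewrite (Dcx F) ?sub0set.
  have : fnum S 0 != 0%N by rewrite -eqz_nat hS hnum0.
  by apply: contraNT => S0; rewrite cards_eq0; apply/eqP/setP => F;
     rewrite !inE cards_eq0; apply: contraNF S0 => /andP[+ /eqP <-]; rewrite inE.
have hull_rk := rk_balanced_hull S0 kappaP.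
exists (V + 'I_(rk Delta))%type, (balanced_hull S kappa); split.
- exact: balanced_hull_cx.
- rewrite /balanced hull_rk; exists (hull_color kappa); exact: hull_color_proper.
- by rewrite /cdim hull_rk.
rewrite /fvector hull_rk; apply: eq_mkseq; apply: hnum_fnum_eq => // i.
by rewrite hnum_balanced_hull.
Qed.
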